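(* Let $\mathcal{G}$ be a Hausdorff, second countable, $\sigma$-compact LCA group which is discrete or compact. Let $0<p,q\leq\infty$ and $m\in\mathcal{M}_v(\mathcal{G}\times\widehat{\mathcal{G}})$. Then there exist $g\in\mathcal{S}_{\mathcal{C}}(\mathcal{G})\setminus\{0\}$ and a constant $C>0$ such that for every $f\in M^{p,q}_m(\mathcal{G})$ $$\|W^{\varrho}_gf\|_{W(L^\infty,L^{p,q}_{\tilde m}(\mathbb{H}_{\mathcal{G}}))}\leq C\,\|W^{\varrho}_gf\|_{L^{p,q}_{\tilde m}(\mathbb{H}_{\mathcal{G}})}.$$
   Context: Setting. $\mathcal{G}$ is written additively; $\widehat{\mathcal{G}}$ is its dual group, $\langle\xi,x\rangle=\xi(x)$; $dx$, $d\xi$ are dual Haar measures. $T_xf(y)=f(y-x)$, $M_\xi f(y)=\langle\xi,y\rangle f(y)$, $\pi(x,\xi)=M_\xi T_x$, $V_gf(x,\xi)=\langle f,\pi(x,\xi)g\rangle$. Special test functions. By the structure theorem $\mathcal{G}\cong\mathbb{R}^d\times\mathcal{G}_0$ with $\mathcal{G}_0$ an LCA group containing a compact open subgroup $\mathcal{K}$ (if $\mathcal{G}$ is discrete or compact, $d=0$ and $\mathcal{G}=\mathcal{G}_0$). The Gaussian is $\varphi(x_1,x_2)=e^{-\pi x_1^2}\chi_{\mathcal{K}}(x_2)$ and $\mathcal{S}_{\mathcal{C}}(\mathcal{G})=\mathrm{span}\{\pi(x,\xi)\varphi\}$. The compact open subgroup $\mathcal{K}$ may be chosen freely (all choices give admissible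 windows and the same modulation spaces). Weights. $v$ is a weight (measurable, positive function) on $\mathcal{G}\times\widehat{\mathcal{G}}$ that is submultiplicative, even, bounded below by a positive constant, with $\lim_n v(n\mathbf{x})^{1/n}=1$ for all $\mathbf{x}$. $\mathcal{M}_v(\mathcal{G}\times\widehat{\mathcal{G}})$ is the set of weights $m$ with $m(\mathbf{x}+\mathbf{y})\le C v(\mathbf{x})m(\mathbf{y})$ for all $\mathbf{x},\mathbf{y}$ and some $C$. Heisenberg group. $\mathbb{H}_{\mathcal{G}}=\mathcal{G}\times\widehat{\mathcal{G}}\times\mathbb{T}$ with $(x,\xi,\tau)(x',\xi',\tau')=(x+x',\xi+\xi',\tau\tau'\langle\xi',x\rangle)$ and Haar measure $dx\,d\xi\,d\tau$ with $d\tau(\mathbb{T})=1$. $\tilde m(x,\xi,\tau)=m(x,\xi)$, and $\|F\|_{L^{p,q}_{\tilde m}(\mathbb{H}_{\mathcal{G}})}=\big(\int_{\widehat{\mathcal{G}}\times\mathbb{T}}(\int_{\mathcal{G}}|F(x,\xi,\tau)|^pm(x,\xi)^pdx)^{q/p}d\xi d\tau\big)^{1/q}$ (usual modifications for $\infty$). For a measurable relatively compact unit neighbourhood $Q\subseteq\mathbb{H}_{\mathcal{G}}$, $\mathsf{M}_QF(h)=\operatorname{ess\,sup}_{y\in hQ}|F(y)|$ and $\|F\|_{W(L^\infty,L^{p,q}_{\tilde m})}=\|\mathsf{M}_QF\|_{L^{p,q}_{\tilde m}}$ (different $Q$ give equivalent quasi-norms). Reservoir and modulation spaces. $\mathcal{T}_{\tilde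 v}=\{f\in L^2(\mathcal{G}):V_{g_0}f\in L^1_v\}$ with norm $\|V_{g_0}f\|_{L^1_v}$, $g_0\in\mathcal{S}_{\mathcal{C}}(\mathcal{G})\setminus\{0\}$ fixed; $\mathcal{R}_{\tilde v}$ is the space of continuous antilinear functionals on $\mathcal{T}_{\tilde v}$. For $f\in\mathcal{R}_{\tilde v}$, $g\in\mathcal{T}_{\tilde v}$: $W^{\varrho}_gf(x,\xi,\tau)=\langle f,\tau M_\xi T_xg\rangle$, so $|W^\varrho_gf(x,\xi,\tau)|=|V_gf(x,\xi)|$. $M^{p,q}_m(\mathcal{G})=\{f\in\mathcal{R}_{\tilde v}:W^{\varrho}_gf\in W(L^\infty,L^{p,q}_{\tilde m}(\mathbb{H}_{\mathcal{G}}))\}$ for a fixed nonzero $g\in\mathcal{S}_{\mathcal{C}}(\mathcal{G})$ (independent of $g$). *)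

(* Defs.v *)
From HB Require Import structures.
From mathcomp Require Import all_boot all_order all_algebra.
From mathcomp Require Import all_classical all_reals all_analysis.
From mathcomp Require Import ess_sup_inf complex.

Set Implicit Arguments.
Unset Strict Implicit.
Unset Printing Implicit Defensive.

Import Order.TTheory GRing.Theory Num.Theory.
Import numFieldNormedType.Exports.

Local Open Scope classical_set_scope.
Local Open Scope ring_scope.

(* [R[i]^o] is the field R[i] with the topology of its norm. *)
Notation cplx R := (R[i]^o) (only parsing).

(* Borel sigma-algebra. A measurableType has to be pointed and a topological
   group is not, so a base point is supplied; it plays no other role. *)
Definition pointed_at (T : choiceType) (x0 : T) : Type := T.
HB.instance Definition _ (T : choiceType) (x0 : T) := Choice.on (pointed_at x0).
HB.instance Definition _ (T : choiceType) (x0 : T) :=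
  isPointed.Build (pointed_at x0) x0.
Definition borel (T : topologicalType) (x0 : T) : Type :=
  g_sigma_algebraType (@open T : set (set (pointed_at x0))).
HB.instance Definition _ (T : topologicalType) (x0 : T) :=
  Measurable.on (borel x0).

Definition cmod (R : realType) (z : R[i]) : R := ComplexField.Normc.normc z.

Section circle.
Context (R : realType).

Record circle := Circle {
  circle_val :> R[i] ;
  circle_valP : `|circle_val| == 1 }.

HB.instance Definition _ := [isSub for circle_val].
HB.instance Definition _ := [Choice of circle by <:].

Lemma circle1_subproof : `|1 : R[i]| == 1. Proof. by rewrite normr1. Qed.
Definition circle1 := Circle circle1_subproof.

Lemma circleM_subproof (z w : circle) : `|(z : R[i]) * w| == 1.
Proof.
by rewrite normrM (eqP (circle_valP z)) (eqP (circle_valP w)) mulr1.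
Qed.
Definition circleM z w := Circle (circleM_subproof z w).

Lemma circleV_subproof (z : circle) : `|(z : R[i])^-1| == 1.
Proof. by rewrite normfV (eqP (circle_valP z)) invr1. Qed.
Definition circleV z := Circle (circleV_subproof z).

Lemma circle_neq0 (z : circle) : (z : R[i]) != 0.
Proof. by rewrite -normr_eq0 (eqP (circle_valP z)) oner_eq0. Qed.

Lemma circleMA : associative circleM.
Proof. by move=> x y z; apply/val_inj => /=; rewrite mulrA. Qed.
Lemma circleMC : commutative circleM.
Proof. by move=> x y; apply/val_inj => /=; rewrite mulrC. Qed.
Lemma circle1M : left_id circle1 circleM.
Proof. by move=> x; apply/val_inj => /=; rewrite mul1r. Qed.
Lemma circleM1 : right_id circle1 circleM.
Proof. by move=> x; apply/val_inj => /=; rewrite mulr1. Qed.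
Lemma circleVM : left_inverse circle1 circleV circleM.
Proof. by move=> x; apply/val_inj => /=; rewrite mulVf// circle_neq0. Qed.
Lemma circleMV : right_inverse circle1 circleV circleM.
Proof. by move=> x; rewrite circleMC circleVM. Qed.

HB.instance Definition _ := isGroup.Build circle
  circleMA circle1M circleM1 circleVM circleMV.
HB.instance Definition _ := Topological.copy circle
  (initial_topology (circle_val : circle -> cplx R)).

End circle.

Section dual.
Context (R : realType) (G : topologicalZmodType).

Definition is_character (xi : G -> circle R) : Prop :=
  continuous xi /\ forall x y, xi (x + y) = (xi x * xi y)%g.

Record dual := Dual {
  dual_val :> G -> circle R ;
  dual_valP : `[< is_character dual_val >] }.

HB.instance Definition _ := [isSub for dual_val].
HB.instance Definition _ := [Choice of dual by <:].
HB.instance Definition _ := Topological.copy dual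
  (initial_topology (dual_val : dual -> {compact-open, G -> circle R})).

Lemma continuous_circleP (f : G -> circle R) :
  continuous f <-> continuous ((fun x => f x : cplx R) : G -> cplx R).
Proof.
split=> [cf|]; last exact: continuous_comp_initial.
have cval : continuous (@circle_val R : circle R -> cplx R).
  exact: initial_continuous.
move=> x; have cvalx := cval (f x).
exact: (@continuous_comp _ _ _ f (@circle_val R : _ -> cplx R) x (cf x) cvalx).
Qed.

Lemma character1_subproof : `[< is_character (fun=> 1%g) >].
Proof. by apply/asboolP; split=> [|x y]; [exact: cst_continuous|rewrite mulg1]. Qed.

Lemma characterM_subproof (xi eta : dual) :
  `[< is_character (fun x => xi x * eta x)%g >].
Proof.
apply/asboolP.
have [cxi xiD] := asboolP _ (dual_valP xi).
have [ceta etaD] := asboolP _ (dual_valP eta).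
split=> [|x y].
  apply/continuous_circleP => x.
  by apply: cvgM; [move/continuous_circleP: cxi; exact
                  |move/continuous_circleP: ceta; exact].
rewrite xiD etaD; apply/val_inj => /=.
by rewrite mulrACA.
Qed.

Lemma characterV_subproof (xi : dual) : `[< is_character (fun x => (xi x)^-1)%g >].
Proof.
apply/asboolP; have [cxi xiD] := asboolP _ (dual_valP xi).
split=> [|x y].
  apply/continuous_circleP => x.
  apply: cvgV; first exact: circle_neq0.
  by move/continuous_circleP: cxi; exact.
by rewrite xiD; apply/val_inj; rewrite /= invfM.
Qed.

Definition character1 := Dual character1_subproof.
Definition characterM xi eta := Dual (characterM_subproof xi eta).
Definition characterV xi := Dual (characterV_subproof xi).

Lemma characterMA : associative characterM.
Proof. by move=> x y z; apply/val_inj/funext => t /=; rewrite mulgA. Qed.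
Lemma characterMC : commutative characterM.
Proof. by move=> x y; apply/val_inj/funext => t /=; exact: circleMC. Qed.
Lemma character1M : left_id character1 characterM.
Proof. by move=> x; apply/val_inj/funext => t /=; rewrite mul1g. Qed.
Lemma characterVM : left_inverse character1 characterV characterM.
Proof. by move=> x; apply/val_inj/funext => t /=; rewrite mulVg. Qed.

HB.instance Definition _ := GRing.isZmodule.Build dual
  characterMA characterMC character1M characterVM.

End dual.

Arguments circle_val {R} _.
Arguments dual_val {R G} _ _.

Section haar.
Context (R : realType) (T : topologicalType) (e : T) (op : T -> T -> T).

Definition radon_measure (mu : {measure set (borel e) -> \bar R}) : Prop :=
  [/\ forall K : set T, compact K -> (mu K < +oo)%E,
      forall A : set (borel e), measurable A ->
        mu A = ereal_inf [set mu U | U in [set U : set T | open U /\ A `<=` U]] &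
      forall U : set T, open U ->
        mu U = ereal_sup [set mu K | K in [set K : set T | compact K /\ K `<=` U]]].

Definition haar_measure (mu : {measure set (borel e) -> \bar R}) : Prop :=
  [/\ radon_measure mu, (0 < mu [set: borel e])%E &
      forall (a : T) (A : set (borel e)), measurable A ->
        mu [set op a x | x in A] = mu A].

End haar.

Definition sigma_compact (T : topologicalType) : Prop :=
  exists2 K : nat -> set T, (forall n, compact (K n)) & \bigcup_n K n = setT.

Section integration.
Context d (T : measurableType d) (R : realType).

Definition cmeasurable (f : T -> R[i]) : Prop :=
  measurable_fun setT (f : T -> borel (0 : cplx R)).

Definition cintegrable (mu : {measure set T -> \bar R}) (f : T -> R[i]) : Prop :=
  cmeasurable f /\ (\int[mu]_x (cmod (f x))%:E < +oo)%E.

Definition square_integrable (mu : {measure set T -> \bar R}) (f : T -> R[i]) :=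
  cmeasurable f /\ (\int[mu]_x (cmod (f x) ^+ 2)%:E < +oo)%E.

Definition cintegral (mu : {measure set T -> \bar R}) (f : T -> R[i]) : R[i] :=
  Complex (Rintegral mu setT (fun x => complex.Re (f x)))
          (Rintegral mu setT (fun x => complex.Im (f x))).

End integration.

Section time_frequency.
Context (R : realType) (G : topologicalZmodType).
Local Notation Gd := (dual R G).
Local Notation C := R[i].

Definition pairing (xi : Gd) (x : G) : C := xi x.

Definition translation (x : G) (f : G -> C) : G -> C := fun y => f (y - x).
Definition modulation (xi : Gd) (f : G -> C) : G -> C :=
  fun y => pairing xi y * f y.
Definition tfshift (z : G * Gd) (f : G -> C) : G -> C :=
  modulation z.2 (translation z.1 f).

Definition open_compact_subgroup (K : set G) : Prop :=
  [/\ compact K, open K, K 0 & forall x y, K x -> K y -> K (x - y)].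

(* The Gaussian for d = 0 in G = R^d x G_0, the case of a discrete or of a
   compact group. *)
Definition gaussian (K : set G) : G -> C := fun x => \1_K x.

Definition special_test_functions (K : set G) : set (G -> C) :=
  [set g | exists (n : nat) (c : 'I_n -> C) (z : 'I_n -> G * Gd),
     g = fun y => \sum_(i < n) c i * tfshift (z i) (gaussian K) y].

Definition heisenberg : Type := (G * Gd * circle R)%type.
HB.instance Definition _ := Topological.on heisenberg.
Definition heis_one : heisenberg := ((0, 0), 1%g).
Definition heis_mul (h k : heisenberg) : heisenberg :=
  ((h.1.1 + k.1.1, h.1.2 + k.1.2), (h.2 * k.2 * k.1.2 h.1.1)%g).

(* Products carry the product of the Borel sigma-algebras, which is the Borel
   sigma-algebra of the product for second countable spaces. *)
Definition weight (v : G * Gd -> R) : Prop :=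
  measurable_fun setT (v : borel (0 : G) * borel (0 : Gd) -> R) /\
  forall z, 0 < v z.

Definition admissible_weight (v : G * Gd -> R) : Prop :=
  [/\ weight v,
      forall z w, v (z + w) <= v z * v w,
      forall z, v (- z) = v z,
      exists2 c : R, 0 < c & forall z, c <= v z &
      forall z, (fun n : nat => v (z *+ n) `^ (n%:R^-1)) @ \oo --> (1 : R)].

Definition moderate_weight (v m : G * Gd -> R) : Prop :=
  weight m /\ exists C : R, forall z w, m (z + w) <= C * v z * m w.

(* A Haar measure of a sigma-compact group is sigma-finite, and the dual of a
   second countable locally compact abelian group is sigma-compact: asking for
   sigma-finite measures (needed for product measures) is no restriction. *)
Section measures.
Context (mu : {sigma_finite_measure set (borel (0 : G)) -> \bar R})
        (nu : {sigma_finite_measure set (borel (0 : Gd)) -> \bar R})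
        (lam : {sigma_finite_measure set (borel (1%g : circle R)) -> \bar R}).

Definition fourier (f : G -> C) : Gd -> C :=
  fun xi => cintegral mu (fun y : borel (0 : G) => f y * conjc (pairing xi y)).

(* nu is dual to mu when the Fourier inversion formula holds without a
   constant. *)
Definition dual_haar_measures : Prop :=
  forall f : G -> C, continuous (f : G -> cplx R) ->
    cintegrable mu (f : borel (0 : G) -> C) ->
    cintegrable nu (fourier f : borel (0 : Gd) -> C) ->
    forall x, f x =
      cintegral nu (fun xi : borel (0 : Gd) => fourier f xi * pairing xi x).

Definition stft (g f : G -> C) : G * Gd -> C :=
  fun z => cintegral mu (fun y : borel (0 : G) => f y * conjc (tfshift z g y)).

Definition L1v_norm (v : G * Gd -> R) (F : G * Gd -> C) : \bar R :=
  (\int[(mu \x nu)%E]_z (cmod (F z) * v z)%:E)%E.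

Definition test_norm (v : G * Gd -> R) (g0 f : G -> C) : \bar R :=
  L1v_norm v (stft g0 f).

Definition test_space (v : G * Gd -> R) (g0 : G -> C) : set (G -> C) :=
  [set f | [/\ square_integrable mu (f : borel (0 : G) -> C),
               cmeasurable (stft g0 f : borel (0 : G) * borel (0 : Gd) -> C) &
               (test_norm v g0 f < +oo)%E]].

(* [f h] is <f, h>, relevant for h in the test space only. Elements of L^2 are
   represented by functions: by continuity f takes the same value on functions
   of the test space that agree almost everywhere. *)
Definition reservoir (v : G * Gd -> R) (g0 : G -> C) : set ((G -> C) -> C) :=
  [set f | (forall (a : C) (h k : G -> C),
              test_space v g0 h -> test_space v g0 k ->
              f (fun y => a * h y + k y) = conjc a * f h + f k) /\
           (forall h, test_space v g0 h ->
            forall eps : R, 0 < eps -> exists2 delta : R, 0 < delta &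
            forall k, test_space v g0 k ->
              (test_norm v g0 (fun y => k y - h y)%R < delta%:E)%E ->
              cmod (f k - f h) < eps)].

Definition wavelet (g : G -> C) (f : (G -> C) -> C) : heisenberg -> C :=
  fun h => f (fun y => (h.2 : C) * tfshift h.1 g y).

Definition mixed_norm (p q : \bar R) (m : G * Gd -> R)
    (F : heisenberg -> \bar R) : \bar R :=
  Lnorm (nu \x lam)%E q (fun z : borel (0 : Gd) * borel (1%g : circle R) =>
    Lnorm mu p (fun x : borel (0 : G) =>
      (`|F ((x, z.1), z.2)| * (m (x, z.1))%:E)%E)).

Definition Lpq_norm (p q : \bar R) (m : G * Gd -> R) (F : heisenberg -> C) :=
  mixed_norm p q m (fun h => (cmod (F h))%:E).

(* The essential supremum over h Q, as that of |F| extended by 0 outside h Q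
   (h Q has positive measure). *)
Definition maximal_fun (Q : set heisenberg) (F : heisenberg -> C) :
    heisenberg -> \bar R :=
  fun h => ess_sup ((mu \x nu) \x lam)%E
    ((fun k : heisenberg => (cmod (F k))%:E) \_ [set heis_mul h k | k in Q]).

Definition wiener_norm (Q : set heisenberg) (p q : \bar R) (m : G * Gd -> R)
    (F : heisenberg -> C) : \bar R :=
  mixed_norm p q m (maximal_fun Q F).

Definition wiener_amalgam (Q : set heisenberg) (p q : \bar R)
    (m : G * Gd -> R) : set (heisenberg -> C) :=
  [set F | cmeasurable
             (F : borel (0 : G) * borel (0 : Gd) * borel (1%g : circle R) -> C)
           /\ (wiener_norm Q p q m F < +oo)%E].

Definition modulation_space (v : G * Gd -> R) (g0 g1 : G -> C)
    (Q : set heisenberg) (p q : \bar R) (m : G * Gd -> R) :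
    set ((G -> C) -> C) :=
  [set f | reservoir v g0 f /\ wiener_amalgam Q p q m (wavelet g1 f)].

End measures.

Definition unit_neighbourhood (Q : set heisenberg) : Prop :=
  [/\ measurable
        (Q : set (borel (0 : G) * borel (0 : Gd) * borel (1%g : circle R))),
      precompact Q & nbhs heis_one Q].

End time_frequency.

(* Main.v *)
From HB Require Import structures.
Require Import Defs.
From mathcomp Require Import all_boot all_order all_algebra.
From mathcomp Require Import all_classical all_reals all_analysis.
From mathcomp Require Import measurable_realfun ess_sup_inf complex.
From mathcomp Require Import ring lra.

(* The window is phi = \1_K itself, for the given K. Since phi is invariant under
   translations by K and is only multiplied by scalars when a translate of it is
   modulated by a character of the annihilator P of K, |V_phi f| is constant on
   the cosets of K x P. As K is compact and open, P is open and compact, so the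
   relatively compact Q meets only finitely many cosets z_i + K x P: the maximal
   function is bounded by max_i |V_phi f (. + z_i)|, and the claim follows from
   moderateness of m and translation invariance of the measures. The functional
   f is antilinear on the test space only, so the time-frequency shifts of phi
   must be shown to lie in it: V_g0 (pi(u) phi) is supported in finitely many
   cosets of K x P, on which v is bounded. *)

Set Implicit Arguments.
Unset Strict Implicit.
Unset Printing Implicit Defensive.

Import Order.TTheory GRing.Theory Num.Theory.
Import numFieldNormedType.Exports.

Local Open Scope classical_set_scope.
Local Open Scope ring_scope.

(** * Lebesgue norms *)

(** Exponents below 1 are allowed, so there is no triangle inequality to rely on: a pointwise
    maximum over finitely many translates is bounded by adding powers and keeping the translate of
    largest norm. This is done separately in the variable of G and in the frequency, because the
    index kept in G varies with the frequency. Membership of f in the modulation space gives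
    measurability of the transform for the window [g1] only; for phi it is deduced from coset
    invariance, as sigma-finiteness of the Haar measures leaves only countably many cosets. The
    number of cosets depends on Q and K alone, so C is fixed before f. Openness of P rests on the
    absence of small subgroups in the circle, its compactness on that of the circle. *)

Section Lnorm_extra.
Context d (T : measurableType d) (R : realType).
Variable mu : {measure set T -> \bar R}.
Local Open Scope ereal_scope.

(* Applied to the maximal function, whose measurability is not established. *)
Lemma le_integral_nonneg (f g : T -> \bar R) :
  (forall x, 0 <= f x) -> (forall x, f x <= g x) ->
  \int[mu]_x f x <= \int[mu]_x g x.
Proof.
move=> f0 fg; have g0 x : 0 <= g x by exact: le_trans (fg x).
rewrite !ge0_integralTE//; apply: ereal_sup_le => _ [h hf <-].
by exists h => // x; exact: le_trans (fg x).
Qed.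

(** For finite p, the integral of |f|^p is at most the sum of the integrals of (k F_i)^p, hence at
    most n+1 times the largest of them; the root gives c = (n+1)^(1/p). The constant precedes the
    functions and k because the lemma is applied at every frequency with a common c. *)
Lemma le_Lnorm_finite_sup (n : nat) (p : \bar R) : 0 < p ->
  exists2 c : R, (0 < c)%R &
  forall (F : 'I_n.+1 -> T -> \bar R) (f : T -> \bar R) (k : R),
    (0 <= k)%R -> (forall i, measurable_fun setT (F i)) ->
    (forall i t, 0 <= F i t) ->
    (forall t, exists i, `|f t| <= k%:E * F i t) ->
    exists i, Lnorm mu p f <= (c * k)%:E * Lnorm mu p (F i).
Proof.
case: p => [r||]; last by rewrite ltNge leNye.
- rewrite lte_fin => r0; exists (n.+1%:R `^ r^-1)%R; first exact: powR_gt0.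
  move=> F f k k0 mF F0 fF.
  have mFr i : measurable_fun setT (fun t => (F i t) `^ r).
    by apply: (measurableT_comp (@measurable_poweR R r)); exact: mF.
  pose J i := \int[mu]_t (F i t) `^ r.
  pose j := [arg max_(i > ord0) J i]%O.
  have Jj i : J i <= J j.
    by rewrite /j; case: arg_maxP => // i0 _; apply.
  have J0 i : 0 <= J i by apply: integral_ge0 => t _; exact: poweR_ge0.
  exists j; rewrite unlock.
  have -> : \int[mu]_t `|F j t| `^ r = J j.
    by apply: eq_integral => t _; rewrite gee0_abs.
  have rV0 : (0 <= r^-1)%R by rewrite invr_ge0 ltW.
  have kr : ((k `^ r) `^ r^-1 = k)%R by rewrite -powRrM mulfV ?gt_eqF// powRr1.
  have -> : ((n.+1%:R `^ r^-1) * k)%:E * (J j) `^ r^-1 =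
            (((n.+1%:R * (k `^ r))%:E) * J j) `^ r^-1.
    rewrite poweRM//; last by rewrite lee_fin mulr_ge0// powR_ge0.
    by congr (_ * _); rewrite poweR_EFin powRM ?powR_ge0// kr.
  have Jf0 : 0 <= \int[mu]_t `|f t| `^ r.
    by apply: integral_ge0 => t _; exact: poweR_ge0.
  apply: gt0_ler_poweR => //.
  - by rewrite in_itv/= Jf0 leey.
  - rewrite in_itv/= leey andbT; apply: mule_ge0 => //.
    by rewrite lee_fin mulr_ge0// powR_ge0.
  have kr0 : 0 <= (k `^ r)%:E by rewrite lee_fin powR_ge0.
  (* At each t the sum contains the term that dominates f at t, and the other terms are
     nonnegative. *)
  apply: (@le_trans _ _
    (\int[mu]_t \sum_(i < n.+1) ((k `^ r)%:E * (F i t) `^ r))).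
    apply: le_integral_nonneg => t; first exact: poweR_ge0.
    have [i fi] := fF t.
    rewrite (bigD1 i)//= -[leLHS]adde0; apply: leeD.
      rewrite -poweR_EFin -poweRM//.
      apply: gt0_ler_poweR => //; rewrite ?ltW ?in_itv/= ?abse_ge0 ?leey//.
      by rewrite andbT mule_ge0.
    by apply: sume_ge0 => l _; rewrite mule_ge0// poweR_ge0.
  rewrite ge0_integral_sum//; last 2 first.
  - by move=> i; exact: measurable_funeM.
  - by move=> i t _; rewrite mule_ge0// poweR_ge0.
  have -> : ((n.+1%:R * (k `^ r))%:E) * J j =
    \sum_(i < n.+1) ((k `^ r)%:E * J j).
    rewrite sumr_const card_ord EFinM -muleA.
    exact: mule_natl.
  apply: lee_sum => i _.
  rewrite ge0_integralZl// => [|t _]; last exact: poweR_ge0.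
  by apply: lee_wpmul2l => //; exact: Jj.
- move=> _; exists 1%R => // F f k k0 mF F0 fF.
  pose J i := Lnorm mu +oo (F i).
  pose j := [arg max_(i > ord0) J i]%O.
  have Jj i : J i <= J j.
    by rewrite /j; case: arg_maxP => // i0 _; apply.
  exists j; rewrite mul1r.
  (* [Lnorm] with exponent +oo is 0 by convention on a space of measure zero. *)
  have [mu0|mu0] := boolP (0 < mu [set: T]); last first.
    have -> : Lnorm mu +oo f = 0 by rewrite unlock ifN.
    by rewrite mule_ge0// Lnorm_ge0.
  have JE i : J i = ess_sup mu (F i).
    rewrite /J unlock ifT//; apply: eq_ess_sup.
    by apply: nearW => t /=; rewrite gee0_abs.
  have -> : Lnorm mu +oo f = ess_sup mu (abse \o f) by rewrite unlock ifT.
  apply/ess_supP.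
  have : \forall t \ae mu, forall i : 'I_n.+1, F i t <= J i.
    (* The finitely many almost-everywhere bounds are indexed by nat through [inord], so that they
       can be merged as a countable family. *)
    have h (l : nat) : \forall t \ae mu, F (inord l) t <= J (inord l).
      by rewrite JE; exact: ess_sup_ge.
    have := ae_foralln h; apply: filterS => t + i => /(_ (nat_of_ord i)).
    by rewrite inord_val.
  apply: filterS => t FJ /=; have [i fi] := fF t.
  apply: (le_trans fi); apply: lee_wpmul2l; first by rewrite lee_fin.
  exact: le_trans (Jj i).
Qed.

End Lnorm_extra.

Section measure_preserving.
Context d d' (T1 : measurableType d) (T2 : measurableType d') (R : realType).
Variables (m1 : {measure set T1 -> \bar R}) (m2 : {measure set T2 -> \bar R}).
Variable phi : T1 -> T2.
Hypothesis mphi : measurable_fun setT phi.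
Hypothesis phi_pres : forall A, measurable A -> m1 (phi @^-1` A) = m2 A.
Local Open Scope ereal_scope.

Lemma ge0_integral_preserving (f : T2 -> \bar R) :
  measurable_fun setT f -> (forall y, 0 <= f y) ->
  \int[m1]_x f (phi x) = \int[m2]_y f y.
Proof.
move=> mf f0.
transitivity (\int[pushforward m1 phi]_y f y).
  by rewrite ge0_integral_pushforward.
by apply: eq_measure_integral => A mA _; exact: phi_pres.
Qed.

Lemma integral_preserving (f : T2 -> \bar R) : measurable_fun setT f ->
  \int[m1]_x f (phi x) = \int[m2]_y f y.
Proof.
move=> mf; rewrite (integralE m1 setT (f \o phi)) (integralE m2 setT f).
have -> : (f \o phi)^\+ = f^\+ \o phi.
  by apply/funext => x; rewrite /= !funeposE.
have -> : (f \o phi)^\- = f^\- \o phi.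
  by apply/funext => x; rewrite /= !funenegE.
by congr (_ - _); apply: ge0_integral_preserving => //;
  [exact: measurable_funepos|exact: measurable_funeneg].
Qed.

Lemma Lnorm_preserving (p : \bar R) (f : T2 -> \bar R) : 0 < p ->
  measurable_fun setT f -> Lnorm m1 p (f \o phi) = Lnorm m2 p f.
Proof.
move=> p0 mf; rewrite unlock; case: p p0 => [r r0||//] /=.
  congr (_ `^ _).
  apply: (@ge0_integral_preserving (fun y => `|f y| `^ r)).
    apply: (measurableT_comp (@measurable_poweR R r)).
    exact: measurableT_comp.
  by move=> y; exact: poweR_ge0.
move=> _.
have -> : m1 [set: T1] = m2 [set: T2] by rewrite -phi_pres// preimage_setT.
have maf : measurable_fun setT (abse \o f) by exact: measurableT_comp.
case: ifPn => // _.
(* The essential supremum becomes the infimum of the levels whose strict superlevel set is null, a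
   condition that [phi_pres] transports. *)
rewrite !ess_supEmu0//; last exact: (measurableT_comp maf mphi).
congr (ereal_inf _); apply/seteqP; split => y /=; rewrite -phi_pres//;
  rewrite -[X in measurable X]setTI; apply: maf => //; exact: emeasurable_itv.
Qed.

End measure_preserving.

Section measurable_Lnorm.
Context d d' (T1 : measurableType d) (T2 : measurableType d') (R : realType).
Variable m1 : {sigma_finite_measure set T1 -> \bar R}.
Local Open Scope ereal_scope.

(** Tonelli settles finite p. For p = +oo, the essential supremum at y is at most r exactly when the
    section at y of {|G| > r} is null, and the measure of a section is a measurable function of
    y. *)
Lemma measurable_Lnorm (p : \bar R) (G : T1 * T2 -> \bar R) : 0 < p ->
  measurable_fun setT G ->
  measurable_fun setT (fun y => Lnorm m1 p (fun x => G (x, y))).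
Proof.
move=> p0 mG; rewrite unlock; case: p p0 => [r||//].
  move=> r0; apply: (measurableT_comp (@measurable_poweR R r^-1)).
  apply: (@measurable_fun_fubini_tonelli_G _ _ _ _ _ m1
    (fun z => `|G z| `^ r)).
    apply: (measurableT_comp (@measurable_poweR R r)).
    exact: measurableT_comp.
  by move=> z; exact: poweR_ge0.
move=> _; set b := (0 < _); case: b => //.
have maG : measurable_fun setT (abse \o G) by exact: measurableT_comp.
apply: (measurability _ (ErealGenOInfty.measurableE R)) => _ [_ [r ->] <-].
have mB : measurable ((abse \o G) @^-1` `]r%:E, +oo[).
  by rewrite -[X in measurable X]setTI; apply: maG => //;
    exact: emeasurable_itv.
rewrite setTI preimage_itvoy -[X in measurable X]setCK; apply: measurableC.
have m0 : measurable_fun setT (m1 \o ysection ((abse \o G) @^-1` `]r%:E, +oo[)).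
  exact: measurable_fun_ysection.
have := m0 measurableT [set 0] (emeasurable_set1 0).
rewrite setTI; congr measurable; apply/seteqP; split => y /=.
  move=> my0; apply/negP; rewrite -leNgt; apply/ess_supP.
  apply/ae_le_measureP.
    by apply: (measurableT_comp maG); exact: pair2_measurable.
  rewrite -my0; congr (m1 _).
  by apply/seteqP; split=> x /=; rewrite /ysection/= ?inE//.
move/negP; rewrite -leNgt => /ess_supP /ae_le_measureP => h.
rewrite -[RHS]h; last by apply: (measurableT_comp maG); exact: pair2_measurable.
by congr (m1 _); apply/seteqP; split=> x /=; rewrite /ysection/= ?inE//.
Qed.

End measurable_Lnorm.

(** * Open subgroups and Haar measures *)

Section disjoint_family.
Context d (X : measurableType d) (R : realType).
Local Open Scope ereal_scope.

(** An infinite D would put more than mu A / e disjoint pieces, each of measure at least e, inside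
    A. *)
Lemma finite_disjoint_family (mu : {measure set X -> \bar R}) (I : Type)
    (D : set I) (F : I -> set X) (A : set X) (e : R) :
  (0 < e)%R -> measurable A -> mu A < +oo ->
  (forall i, measurable (F i)) -> trivIset D F ->
  (forall i, D i -> e%:E <= mu (A `&` F i)) -> finite_set D.
Proof.
move=> e0 mA Aoo mF tF eF; apply: contrapT => /infiniteP /card_leP[f0].
pose f (n : nat) : I := val (f0 (to_setT n)).
have fD n : D (f n) by exact: set_valP.
have f_inj : injective f.
  move=> i j /val_inj/inj; rewrite !inE => /(_ Logic.I Logic.I).
  by move/(congr1 val).
have mAF i : measurable (A `&` F (f i)) by exact: measurableI.
have tAF : trivIset setT (fun i => A `&` F (f i)).
  move=> i j _ _ [x [[_ Fi] [_ Fj]]].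
  by apply: f_inj; apply: tF => //; exists x.
have sumA : \sum_(i <oo) mu (A `&` F (f i)) <= mu A.
  rewrite -(@measure_semi_bigcup _ _ _ _ (fun i => A `&` F (f i)))//.
    apply: le_measure; rewrite ?inE//; first exact: bigcupT_measurable.
    by move=> x [i _ []].
  exact: bigcupT_measurable.
have A0 : mu A \is a fin_num by rewrite ge0_fin_numE.
pose N := (Num.truncn (fine (mu A) / e)).+1.
have : (N%:R * e)%:E <= mu A.
  apply: le_trans sumA.
  apply: (@le_trans _ _ (\sum_(0 <= i < N) mu (A `&` F (f i)))); last first.
    by apply: (@nneseries_lim_ge R (fun i => mu (A `&` F (f i))) xpredT 0%N).
  rewrite mulr_natl -[X in (_ *+ X)%R](subn0 N) -sumr_const_nat -sumEFin.
  by apply: lee_sum => i _; exact: eF.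
rewrite -(fineK A0) lee_fin leNgt => /negP; apply.
by rewrite -ltr_pdivrMr//; exact: truncnS_gt.
Qed.

(** Along an exhaustion A_n of finite measure, each index i has some n and k for which A_n meets F_i
    in measure at least 1/(k+1); for given n and k only finitely many i qualify. *)
Lemma countable_disjoint_family (mu : {sigma_finite_measure set X -> \bar R})
    (I : Type) (D : set I) (F : I -> set X) :
  (forall i, measurable (F i)) -> trivIset D F ->
  (forall i, D i -> 0 < mu (F i)) -> countable D.
Proof.
move=> mF tF F0.
have /sigma_finiteP[A [AT ndA mA]] := sigma_finiteT mu.
pose E (nk : nat * nat) :=
  [set i | D i /\ (nk.2.+1%:R^-1)%:E <= mu (A nk.1 `&` F i)].
suff -> : D = \bigcup_nk E nk.
  apply: bigcup_countable => // nk _; apply: finite_set_countable.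
  have [mAn Anoo] := mA nk.1.
  apply: (@finite_disjoint_family mu _ _ F (A nk.1) (nk.2.+1%:R^-1)) => //.
  - by move=> i j [Di _] [Dj _]; exact: tF.
  - by move=> i [].
apply/seteqP; split=> [i Di|i [nk _ []]//].
have : exists n, 0 < mu (A n `&` F i).
  apply: contrapT => /forallNP h.
  have := F0 _ Di; rewrite ltNge => /negP; apply.
  have -> : F i = \bigcup_n (A n `&` F i) by rewrite -setI_bigcupl -AT setTI.
  rewrite measure_le0; apply/eqP/negligibleP.
    by apply: bigcupT_measurable => n; apply: measurableI => //;
      exact: (mA n).1.
  apply: negligible_bigcup => n; apply/negligibleP.
    by apply: measurableI => //; exact: (mA n).1.
  by apply/eqP; rewrite -measure_le0 leNgt; apply/negP; exact: h.
move=> [n n0].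
have [k kn] : exists k, (k.+1%:R^-1)%:E <= mu (A n `&` F i).
  have Anoo : mu (A n `&` F i) < +oo.
    apply: le_lt_trans (mA n).2; apply: le_measure; rewrite ?inE//.
    - by apply: measurableI => //; exact: (mA n).1.
    - exact: (mA n).1.
  have Afin : mu (A n `&` F i) \is a fin_num by rewrite ge0_fin_numE.
  rewrite -(fineK Afin); exists (Num.truncn (fine (mu (A n `&` F i)))^-1).
  have f0 : (0 < fine (mu (A n `&` F i)))%R by apply: fine_gt0; rewrite n0.
  by rewrite lee_fin invf_ple ?posrE// ltW// truncnS_gt.
by exists (n, k) => //; split.
Qed.

End disjoint_family.

Section borel_measurability.

Lemma open_borel (T : topologicalType) (x0 : T) (A : set T) :
  open A -> measurable (A : set (borel x0)).
Proof. exact: sub_sigma_algebra. Qed.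

Lemma continuous_borel (T U : topologicalType) (x0 : T) (y0 : U) (f : T -> U) :
  continuous f -> measurable_fun setT (f : borel x0 -> borel y0).
Proof.
move=> /continuousP cf; apply: (@measurability _ _ (borel x0) (borel y0) setT
  f (@open U : set (set (pointed_at y0)))) => //.
by move=> _ [A oA <-]; rewrite setTI; apply: open_borel; exact: cf.
Qed.

End borel_measurability.

Section cosets.
Context (T : PreTopologicalZmodule.type).

(** Cosets are treated in a group with a topology and continuous translations only. This covers both
    G and its dual, for which joint continuity of the addition is not established. *)
Definition open_subgroup (L : set T) : Prop :=
  [/\ open L, L 0 & forall x y, L x -> L y -> L (x - y)].

Definition coset (L : set T) (a : T) : set T := [set x | L (x - a)].

Lemma subgroupN (L : set T) : open_subgroup L -> forall x, L x -> L (- x).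
Proof. by move=> [_ L0 LB] x Lx; rewrite -sub0r; exact: LB. Qed.

Lemma subgroupD (L : set T) : open_subgroup L ->
  forall x y, L x -> L y -> L (x + y).
Proof.
move=> sL x y Lx Ly; rewrite -(opprK y); case: (sL) => _ _; apply => //.
exact: subgroupN.
Qed.

Lemma coset_sym (L : set T) : open_subgroup L ->
  forall x a, coset L a x -> coset L x a.
Proof. by move=> sL x a /(subgroupN sL); rewrite opprB. Qed.

Lemma coset_trans (L : set T) : open_subgroup L ->
  forall x y z, coset L x y -> coset L y z -> coset L x z.
Proof.
move=> sL x y z Lxy Lyz; have := subgroupD sL Lyz Lxy.
by rewrite addrA subrK.
Qed.

Lemma coset_refl (L : set T) : open_subgroup L -> forall x, coset L x x.
Proof. by move=> [_ L0 _] x; rewrite /coset/= subrr. Qed.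

Lemma coset_eq (L : set T) : open_subgroup L ->
  forall x y, coset L x y -> coset L x = coset L y.
Proof.
move=> sL x y xy; apply/seteqP; split=> z xz; apply: (coset_trans sL) xz => //.
exact: coset_sym.
Qed.

Hypothesis addl_continuous : forall a : T, continuous (fun x => a + x).

Lemma coset_open (L : set T) : open_subgroup L -> forall a, open (coset L a).
Proof.
move=> [oL _ _] a.
have -> : coset L a = (fun x => - a + x) @^-1` L.
  by apply/seteqP; split => x /=; rewrite /coset/= addrC.
by apply: open_comp => // x _; exact: addl_continuous.
Qed.

Lemma coset_nbhs (L : set T) : open_subgroup L -> forall x, nbhs x (coset L x).
Proof.
move=> sL x; apply: open_nbhs_nbhs.
by split; [exact: coset_open|exact: coset_refl].
Qed.

Lemma compact_finite_cosets (L : set T) : open_subgroup L ->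
  forall A : set T, compact A ->
  exists s : seq T, forall x, A x -> exists2 a, a \in s & coset L a x.
Proof.
move=> sL A /compact_near_coveringP cA.
(* The filter of properties shared by all sequences containing some finite set of points.
   Compactness as near-covering then produces one sequence that serves all of A. *)
pose F : set_system (seq T) :=
  [set P | exists s0 : seq T, forall s : seq T, {subset s0 <= s} -> P s].
have FF : Filter F.
  split.
  - by exists [::].
  - move=> P Q [s1 P1] [s2 Q2]; exists (s1 ++ s2) => s s12; split.
      by apply: P1 => x x1; apply: s12; rewrite mem_cat x1.
    by apply: Q2 => x x2; apply: s12; rewrite mem_cat x2 orbT.
  - by move=> P Q PQ [s0 P0]; exists s0 => s /P0; exact: PQ.
have [|s0 /(_ s0 (fun _ => id)) As0] :=
  cA _ F (fun s x => exists2 a, a \in s & coset L a x) FF.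
  move=> x Ax; exists (coset L x, [set s : seq T | x \in s]) => /=.
    split; last by exists [:: x] => s; apply; rewrite inE.
    exact: coset_nbhs.
  by move=> [y s] /= [xy xs]; exists x.
by exists s0 => x /As0.
Qed.

End cosets.

Section haar.
Context (R : realType) (T : PreTopologicalZmodule.type).
Hypothesis addl_continuous : forall a : T, continuous (fun x => a + x).
Hypothesis T_hausdorff : hausdorff_space T.
Variable mu : {sigma_finite_measure set (borel (0%R : T)) -> \bar R}.
Hypothesis mu_haar : haar_measure +%R mu.
Variable L : set T.
Hypotheses (L_compact : compact L) (L_subgroup : open_subgroup L).
Local Open Scope ereal_scope.

Let oL : open L. Proof. by case: L_subgroup. Qed.
Let mcoset a : measurable (coset L a : set (borel (0%R : T))).
Proof. by apply: open_borel; exact: coset_open. Qed.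

Lemma measurable_addl (a : T) :
  measurable_fun setT ((fun x => a + x)%R : borel (0%R : T) -> borel (0%R : T)).
Proof. by apply: continuous_borel; exact: addl_continuous. Qed.

Lemma measurable_addr (a : T) :
  measurable_fun setT ((fun x => x + a)%R : borel (0%R : T) -> borel (0%R : T)).
Proof. by under eq_fun do rewrite addrC; exact: measurable_addl. Qed.

Lemma haar_addr (a : T) (A : set (borel (0%R : T))) : measurable A ->
  mu ((fun x => (x + a)%R : borel (0%R : T)) @^-1` A) = mu A.
Proof.
case: mu_haar => _ _ inv mA; rewrite -(inv (- a)%R A mA); congr (mu _).
apply/seteqP; split => x /=.
  by move=> Axa; exists (x + a)%R => //; rewrite addrC addrK.
by move=> [y Ay <-]; rewrite addrAC addNr add0r.
Qed.

Lemma haar_coset (a : T) : mu (coset L a) = mu L.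
Proof. by rewrite -(haar_addr (- a)%R (@open_borel T 0%R L oL)). Qed.

Lemma haar_compact_lty : mu L < +oo.
Proof. by case: mu_haar => -[h _ _] _ _; exact: h. Qed.

(** If L were null, so would be its cosets, hence every compact set, being covered by finitely many
    of them; inner regularity on the whole space would then make mu zero. *)
Lemma haar_open_subgroup_gt0 : 0 < mu L.
Proof.
rewrite lt0e measure_ge0 andbT; apply/eqP => L0.
case: mu_haar => -[_ _ /(_ setT openT) muT] T0 _; move: T0.
rewrite muT ltNge => /negP; apply; apply: ge_ereal_sup => _ [A [cA _] <-].
have [s As] := compact_finite_cosets addl_continuous L_subgroup cA.
have : mu.-negligible (\bigcup_(i in [set i : nat | (i < size s)%N])
    (coset L (nth 0%R s i) : set (borel (0%R : T)))).
  rewrite bigcup_mkcond; apply: negligible_bigcup => n.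
  case: ifPn => _; last exact: negligible_set0.
  apply/negligibleP; first exact: mcoset.
  exact: etrans (haar_coset _) L0.
have mU : measurable (\bigcup_(i in [set i : nat | (i < size s)%N])
    (coset L (nth 0%R s i) : set (borel (0%R : T)))).
  by apply: bigcup_measurable => n _; exact: mcoset.
move=> /(negligibleP _ mU) U0.
have mA : measurable (A : set (borel (0%R : T))).
  rewrite -[X in measurable X]setCK; apply: measurableC; apply: open_borel.
  by apply: closed_openC; exact: compact_closed.
rewrite -[leRHS]U0; apply: le_measure; rewrite ?inE// => x /As [a asz ax].
by exists (index a s); rewrite /= ?index_mem// nth_index.
Qed.

(* Countability comes from sigma-finiteness: distinct cosets are disjoint and all
   have the same positive measure. *)
Lemma countable_cosets :
  exists2 D : set T, countable D & forall x, exists2 a, D a & coset L a x.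
Proof.
(* The representative depends on the coset as a set, so all points of one coset receive the same
   one. *)
pose r x := xget 0%R (coset L x).
have rP x : coset L x (r x).
  by rewrite /r; case: xgetP => [y ->//|/(_ x)]; case; exact: coset_refl.
have rE x y : coset L x y -> r x = r y.
  by move=> xy; rewrite /r (coset_eq L_subgroup xy).
exists (range r); last first.
  by move=> x; exists (r x); [exists x|exact: coset_sym].
apply: (@countable_disjoint_family _ (borel (0%R : T)) R mu T (range r)
  (coset L)).
- exact: mcoset.
- move=> _ _ [x _ <-] [y _ <-] [z [zx zy]]; apply: rE.
  apply: (coset_trans L_subgroup) (rP x) _.
  apply: (coset_trans L_subgroup) zx _.
  apply: (coset_sym L_subgroup); apply: (coset_trans L_subgroup) (rP y) zy.
- by move=> a _; rewrite haar_coset haar_open_subgroup_gt0.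
Qed.

(* The sets {w <= n} exhaust L, so one of them fills more than half of L; two
   translates of it then meet, and w <= n ^ 2 on L. *)
Lemma submultiplicative_bounded (w : T -> R) :
  measurable_fun setT (w : borel (0%R : T) -> R) ->
  (forall x, 0 <= w x)%R ->
  (forall x y, w (x + y) <= w x * w y)%R -> (forall x, w (- x) = w x)%R ->
  exists2 M : R, (0 < M)%R & forall x, L x -> (w x <= M)%R.
Proof.
move=> mw w0 wD wN.
have mL : measurable (L : set (borel (0%R : T))) by exact: open_borel.
pose A (n : nat) : set (borel (0%R : T)) := [set x | (w x <= n%:R)%R] `&` L.
have mA n : measurable (A n).
  apply: measurableI => //.
  have := mw measurableT _ (measurable_itv `]-oo, (n%:R : R)]).
  by rewrite setTI; congr measurable; apply/seteqP; split => x /=;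
    rewrite in_itv.
have LA : L = \bigcup_n A n.
  apply/seteqP; split=> [x Lx|x [n _ []]//].
  by exists (Num.truncn (w x)).+1 => //; split => //=; rewrite ltW// truncnS_gt.
have ndA : nondecreasing_seq A.
  move=> n k nk; apply/subsetPset => x [/= wx Lx]; split => //=.
  by rewrite (le_trans wx)// ler_nat.
have Lfin : mu L \is a fin_num by rewrite ge0_fin_numE// haar_compact_lty.
(* Otherwise every A_n has at most half the measure of L, and continuity from below gives mu L <= mu
   L / 2, although 0 < mu L < +oo. *)
have [n An] : exists n, mu L < mu (A n) + mu (A n).
  apply: contrapT => /forallNP h.
  have : mu (\bigcup_n A n) <= (fine (mu L) / 2)%:E.
    have cA :=
      @nondecreasing_cvg_mu _ _ _ mu A mA (bigcupT_measurable _ mA) ndA.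
    rewrite -(cvg_lim _ cA)//; apply: lime_le.
      by apply/cvg_ex; eexists; exact: cA.
    apply: nearW => n /=; have := h n => /negP; rewrite -leNgt.
    have Anfin : mu (A n) \is a fin_num.
      rewrite ge0_fin_numE//; apply: le_lt_trans haar_compact_lty.
      by apply: le_measure; rewrite ?inE// => x [].
    rewrite -(fineK Anfin) -(fineK Lfin) -EFinD !lee_fin ler_pdivlMr//.
    by rewrite mulr_natr mulr2n.
  rewrite -LA -(fineK Lfin) lee_fin ler_pdivlMr// mulr_natr mulr2n.
  rewrite gerDl leNgt => /negP; apply; apply: fine_gt0.
  by rewrite haar_open_subgroup_gt0 haar_compact_lty.
(* Adding 1 only serves to make the bound positive. *)
exists (n%:R * n%:R + 1)%R; first by rewrite ltr_wpDl// mulr_ge0.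
move=> x Lx.
pose B : set (borel (0%R : T)) :=
  (fun y => (y - x)%R : borel (0%R : T)) @^-1` A n.
have mB : measurable B by rewrite -[B]setTI; exact: (measurable_addr (- x)%R).
have BL : B `<=` L.
  by move=> y [_ /(subgroupD L_subgroup)/(_ Lx)]; rewrite subrK.
have muB : mu B = mu (A n) by exact: haar_addr.
have : exists y, A n y /\ B y.
  apply: contrapT => /forallNP AB.
  have : mu (A n `|` B) <= mu L.
    apply: le_measure; rewrite ?inE//; first exact: measurableU.
    by move=> y [[]//|/BL].
  have ABE : A n `&` B = set0 by apply/seteqP; split=> y //= /AB.
  have mUE : mu (A n `|` B) = mu (A n) + mu (A n).
    by rewrite -[X in _ = _ + X]muB; exact: measureU.
  by rewrite mUE => /(lt_le_trans An); rewrite ltxx.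
move=> [y [[/= wy _] [/= wyx _]]].
(* Both y and y - x lie in A_n, so submultiplicativity and evenness give w x <= n * n. *)
have -> : (x = y - (y - x))%R by rewrite opprB addrC subrK.
apply: (le_trans (wD _ _)); rewrite wN; apply: ler_wpDr => //.
exact: ler_pM.
Qed.

End haar.

(** * The dual group *)

Lemma initial_cvgP (S : choiceType) (T : topologicalType) (f : S -> T)
    (I : Type) (F : set_system I) (FF : Filter F) (g : I -> S) (s : S) :
  g x @[x --> F] --> (s : initial_topology f) <-> f (g x) @[x --> F] --> f s.
Proof.
split=> [gs|fgs].
  by move=> A fsA; exact: (gs _ (@initial_continuous S T f s A fsA)).
move=> A [_ [[B oB <-] Bfs BA]].
have : nbhs (f s) B by apply: open_nbhs_nbhs.
by move=> /fgs; apply: (@filterS _ F) => x; exact: BA.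
Qed.

Lemma ultra_fmap (S T : Type) (f : S -> T) (F : set_system S) :
  UltraFilter F -> UltraFilter (f @ F).
Proof.
move=> UF; split=> [|G PG FG]; first exact: fmap_proper_filter.
apply/seteqP; split=> A; last exact: FG.
have [//|FA GA] := in_ultra_setVsetC (f @^-1` A) UF.
have : G (A `&` ~` A) by apply: filterI => //; exact: FG.
by rewrite setICr => /filter_not_empty.
Qed.

Section circle_topology.
Context (R : realType).
Local Notation C := R[i].

Lemma circle_cvgP (I : Type) (F : set_system I) (FF : Filter F)
    (g : I -> circle R) (s : circle R) :
  g x @[x --> F] --> s <-> (g x : cplx R) @[x --> F] --> (s : cplx R).
Proof. exact: (@initial_cvgP (circle R) (cplx R) (@circle_val R)). Qed.

Lemma circle_val_continuous : continuous (@circle_val R : circle R -> cplx R).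
Proof. exact: initial_continuous. Qed.

Lemma circle_mul_cvg (I : Type) (F : set_system I) (FF : Filter F)
    (g h : I -> circle R) (s t : circle R) :
  g x @[x --> F] --> s -> h x @[x --> F] --> t ->
  (g x * h x)%g @[x --> F] --> (s * t)%g.
Proof.
move=> /circle_cvgP gs /circle_cvgP ht; apply/circle_cvgP.
exact: (@cvgM C I F FF (fun x => g x : C^o) (fun x => h x : C^o) _ _ gs ht).
Qed.

Lemma circle_hausdorff : hausdorff_space (circle R).
Proof.
move=> z w zw; apply/val_inj.
have /(_ (cplx R)) hC := @norm_hausdorff C.
apply: hC => A B Az Bw.
have := zw _ _ (circle_val_continuous Az) (circle_val_continuous Bw).
by move=> [u [Au Bu]]; exists (u : cplx R).
Qed.

Lemma cmodE (z : C) : `|z| = (cmod z)%:C%C.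
Proof. by []. Qed.

Lemma Re_le_cmod (z : C) : `|complex.Re z| <= cmod z.
Proof.
case: z => a b; rewrite /cmod/= -sqrtr_sqr ler_wsqrtr// lerDl.
exact: sqr_ge0.
Qed.

Lemma Im_le_cmod (z : C) : `|complex.Im z| <= cmod z.
Proof.
case: z => a b; rewrite /cmod/= -sqrtr_sqr ler_wsqrtr// lerDr.
exact: sqr_ge0.
Qed.

Lemma cmod_le_ReIm (z : C) : cmod z <= `|complex.Re z| + `|complex.Im z|.
Proof.
case: z => a b; rewrite /cmod/=.
rewrite -[leRHS]ger0_norm ?addr_ge0// -sqrtr_sqr ler_wsqrtr//.
rewrite sqrrD !real_normK ?num_real// -addrA lerD2l addrC lerDl.
by rewrite mulrn_wge0// mulr_ge0.
Qed.

Lemma cplx_cvgP (I : Type) (F : set_system I) (FF : Filter F)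
    (f : I -> C) (z : C) :
  (f i : cplx R) @[i --> F] --> (z : cplx R) <->
  forall e : R, 0 < e -> \forall i \near F, cmod (z - f i) < e.
Proof.
split=> [/cvgrPdist_lt fz e e0|fz].
  have : (0 : C) < e%:C%C by rewrite ltcR.
  by move=> /fz; apply: filterS => i; rewrite cmodE ltcR.
(* A positive element of R[i] has zero imaginary part, so real radii suffice. *)
apply/cvgrPdist_lt => -[e e'] /=; rewrite ltcE/= => /andP[/eqP -> e0].
by have := fz _ e0; apply: filterS => i; rewrite cmodE ltcR.
Qed.

Lemma complex_cvg (I : Type) (F : set_system I) (FF : Filter F)
    (a b : I -> R) (x y : R) :
  a i @[i --> F] --> x -> b i @[i --> F] --> y ->
  (Complex (a i) (b i) : cplx R) @[i --> F] --> (Complex x y : cplx R).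
Proof.
move=> /cvgrPdist_lt ax /cvgrPdist_lt bY; apply/cplx_cvgP => e e0.
have e20 : 0 < e / 2 by rewrite divr_gt0.
near=> i; apply: le_lt_trans (cmod_le_ReIm _) _ => /=.
rewrite [ltRHS](splitr e); apply: ltrD; near: i; [exact: ax|exact: bY].
Unshelve. all: by end_near. Qed.

Lemma near_cmod (z : C) (e : R) : 0 < e ->
  \forall w \near (z : cplx R), cmod (z - w) < e.
Proof.
apply: ((cplx_cvgP (nbhs_filter (z : cplx R)) (fun w => w) z).1 _ e).
exact: cvg_id.
Qed.

Lemma Re_continuous : continuous (fun z : cplx R => complex.Re z).
Proof.
move=> z; apply/(cvgrPdist_lt (FF := nbhs_filter (z : cplx R))) => e e0.
have ReB (x y : C) : complex.Re x - complex.Re y = complex.Re (x - y).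
  by case: x y => ? ? [? ?].
near=> w; have : cmod (z - w) < e by near: w; exact: near_cmod.
by apply: le_lt_trans; rewrite ReB; exact: Re_le_cmod.
Unshelve. all: by end_near. Qed.

Lemma Im_continuous : continuous (fun z : cplx R => complex.Im z).
Proof.
move=> z; apply/(cvgrPdist_lt (FF := nbhs_filter (z : cplx R))) => e e0.
have ImB (x y : C) : complex.Im x - complex.Im y = complex.Im (x - y).
  by case: x y => ? ? [? ?].
near=> w; have : cmod (z - w) < e by near: w; exact: near_cmod.
by apply: le_lt_trans; rewrite ImB; exact: Im_le_cmod.
Unshelve. all: by end_near. Qed.

(** The circle is covered by the two half-circles of height sqrt (1 - t ^ 2) and its opposite,
    continuous images of [-1, 1]. The limit in C of an ultrafilter on the circle then lies on them,
    so it has modulus 1 and is a point of the circle. *)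
Lemma circle_compact : compact [set: circle R].
Proof.
pose f (s : bool) (t : R) : cplx R :=
  Complex t ((-1) ^+ s * Num.sqrt (1 - t ^+ 2)).
have cf s : continuous (f s).
  move=> t; apply: complex_cvg; first exact: cvg_id.
  apply: cvgM; first exact: cvg_cst.
  apply: (@cvg_comp R R R (fun t => 1 - t ^+ 2) Num.sqrt (nbhs t)
    (nbhs (1 - t ^+ 2))); last exact: sqrt_continuous.
  by apply: cvgB; [exact: cvg_cst|exact: exprn_continuous].
pose S := f false @` `[-1, 1] `|` f true @` `[-1, 1].
have cS : compact S.
  apply: compactU; apply: continuous_compact; try exact: segment_compact;
  exact: continuous_subspaceT.
have circleS (z : circle R) : S (z : cplx R).
  have := circle_valP z; rewrite cmodE.
  case: (circle_val z) => a b /eqP[]; rewrite /cmod/=.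
  move=> /(congr1 (fun x => x ^+ 2)).
  rewrite sqr_sqrtr ?addr_ge0 ?sqr_ge0// expr1n => ab.
  have aI : a \in `[-1, 1].
    rewrite in_itv/= -ler_norml -(@ler_pXn2r _ 2)// ?nnegrE//.
    by rewrite real_normK ?num_real// expr1n -ab lerDl sqr_ge0.
  have bE : Num.sqrt (1 - a ^+ 2) = `|b| by rewrite -ab addrC addKr sqrtr_sqr.
  have [b0|b0] := leP 0 b; [left|right]; exists a => //; rewrite /f bE.
    by rewrite expr0 mul1r ger0_norm.
  by rewrite expr1 mulN1r ltr0_norm// opprK.
rewrite compact_ultra => F UF _.
move: cS; rewrite compact_ultra => cS.
have UG : UltraFilter ((fun z : circle R => z : cplx R) @ F).
  exact: ultra_fmap.
have [|w [Sw Fw]] := cS _ UG.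
  have F1 : F setT by exact: filterT.
  have FS : F (@circle_val R @^-1` S).
    by apply: (filterS _ F1) => z _; exact: circleS.
  exact: FS.
have cf1 s t : t \in `[-1, 1] -> cmod (f s t) = 1.
  rewrite in_itv/= -ler_norml => t1; have t2 : 0 <= 1 - t ^+ 2.
    by rewrite subr_ge0 -real_normK ?num_real// expr_le1.
  by rewrite /cmod/= exprMn sqrr_sign mul1r sqr_sqrtr// addrC subrK sqrtr1.
have cw : cmod w = 1 by case: Sw => -[t tI <-]; exact: cf1.
have wn : `|w : C| == 1 by rewrite cmodE cw.
exists (Circle wn); split => //=.
by apply/circle_cvgP.
Qed.

End circle_topology.

Section dual_topology.
Context (R : realType) (G : topologicalZmodType).
Local Notation C := R[i].
Local Notation Gd := (dual R G).

Lemma dual_add (xi eta : Gd) x : (xi + eta) x = (xi x * eta x)%g.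
Proof. by []. Qed.

Lemma dual_opp (xi : Gd) x : (- xi) x = (xi x)^-1%g.
Proof. by []. Qed.

Lemma dual_zero x : (0 : Gd) x = 1%g.
Proof. by []. Qed.

Lemma char_continuous (xi : Gd) : continuous (xi : G -> circle R).
Proof. by have /asboolP[] := dual_valP xi. Qed.

Lemma char_val_continuous (xi : Gd) : continuous (fun y => xi y : cplx R).
Proof. exact/continuous_circleP/char_continuous. Qed.

Lemma charD (xi : Gd) x y : xi (x + y) = (xi x * xi y)%g.
Proof. by have /asboolP[_] := dual_valP xi; apply. Qed.

Lemma char0 (xi : Gd) : xi 0 = 1%g.
Proof.
by apply: (@mulgI _ (xi 0)); rewrite -charD addr0 mulg1.
Qed.

Lemma charN (xi : Gd) x : xi (- x) = (xi x)^-1%g.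
Proof.
apply: (@mulgI _ (xi x)).
by rewrite -charD subrr char0 mulgV.
Qed.

Lemma dual_cvgP (F : set_system Gd) (FF : Filter F) (xi : Gd) :
  F --> xi <-> forall (A : set G) (O : set (circle R)), compact A -> open O ->
    (forall x, A x -> O (xi x)) ->
    F [set eta : Gd | forall x, A x -> O (eta x)].
Proof.
have := @initial_cvgP Gd {compact-open, G -> circle R} (@dual_val R G)
  Gd F FF id xi.
move=> E; split=> [Fxi A O cA oO AO|h].
  have /compact_open_cvgP :
    (dual_val eta : {compact-open, G -> circle R}) @[eta --> F] -->
      (dual_val xi : {compact-open, G -> circle R}) by apply/E.
  move=> /(_ A O cA oO) H.
  have AO' : [set dual_val xi x | x in A] `<=` O.
    by move=> _ [x Ax <-]; exact: AO.
  apply: (filterS (F := F)) (H AO') => eta /= etaA x Ax.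
  by apply: etaA; exists x.
apply/E; apply/compact_open_cvgP => A O cA oO AO.
have := h A O cA oO (fun x Ax => AO _ (ex_intro2 _ _ x Ax erefl)).
by apply: (filterS (F := F)) => eta /= etaA _ [x Ax <-]; exact: etaA.
Qed.

Lemma dual_near (xi : Gd) (A : set G) (O : set (circle R)) :
  compact A -> open O -> (forall x, A x -> O (xi x)) ->
  nbhs xi [set eta : Gd | forall x, A x -> O (eta x)].
Proof.
by move=> cA oO AO; apply: ((dual_cvgP (nbhs_filter xi) xi).1 _ A O).
Qed.

Lemma dual_eval_continuous (x : G) : continuous (fun xi : Gd => xi x).
Proof.
move=> xi A; rewrite nbhsE => -[U [oU Uxi] UA].
have h : forall y, [set x] y -> U (xi y) by move=> y ->.
have := @dual_near xi [set x] U (@compact_set1 _ x) oU h.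
by apply: (filterS (F := nbhs xi)) => eta etaU; apply: UA; exact: etaU.
Qed.

Lemma dual_hausdorff : hausdorff_space Gd.
Proof.
move=> xi eta cl; apply/val_inj/funext => x.
apply: circle_hausdorff => A B Ax Bx.
have [zeta [Az Bz]] :=
  cl _ _ (dual_eval_continuous Ax) (dual_eval_continuous Bx).
by exists (zeta x).
Qed.

Variable K : set G.
Hypotheses (K_compact : compact K) (K_subgroup : open_subgroup K).

Lemma topologicalZmod_addl_continuous (a : G) : continuous (fun x : G => a + x).
Proof.
move=> x.
apply: (@cvg_comp _ _ _ (fun y => (a, y)) (fun p : G * G => p.1 + p.2)
  (nbhs x) (nbhs (a, x))); last exact: (@add_continuous G (a, x)).
by apply: cvg_pair; [exact: cvg_cst|exact: cvg_id].
Qed.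

Lemma coset_compact (a : G) : compact (coset K a).
Proof.
have -> : coset K a = (fun x => a + x) @` K.
  apply/seteqP; split=> [x xa|_ [x Kx <-]].
    by exists (x - a) => //; rewrite addrC subrK.
  by rewrite /coset/= addrC addKr.
apply: continuous_compact => //; apply: continuous_subspaceT.
exact: topologicalZmod_addl_continuous.
Qed.

(** Joint continuity of evaluation, for which G has to be locally compact near x: this is supplied
    by the coset of K. Regularity of C gives a closed neighbourhood of xi x inside the open set; its
    preimage under xi in the coset is a compact neighbourhood of x, to which the compact-open
    topology applies. *)
Lemma dual_eval_near (xi : Gd) (x : G) (O : set (circle R)) :
  open O -> O (xi x) ->
  \forall y \near x & eta \near xi, O ((eta : Gd) y).
Proof.
move=> [U oU UO] Oxi; rewrite -UO in Oxi *.
have := @uniform_regular (cplx R) (xi x : C) U.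
case; first by apply: open_nbhs_nbhs.
move=> V Vxi VU.
pose A := coset K x `&` [set y | closure V (xi y : cplx R)].
have cA : compact A.
  apply: compact_closedI; first exact: coset_compact.
  apply: (closed_comp _ (@closed_closure (cplx R) V)) => y _.
  exact: char_val_continuous.
have xA : \forall y \near x, A y.
  apply: filterI.
    exact: (coset_nbhs topologicalZmod_addl_continuous).
  have : nbhs x [set y | V (xi y : cplx R)].
    exact: (char_continuous (circle_val_continuous Vxi)).
  by apply: (filterS (F := nbhs x)) => y /= Vy;
    exact: (@subset_closure (cplx R) V).
have xiA : nbhs xi
    [set eta : Gd | forall y, A y -> (@circle_val R @^-1` U) (eta y)].
  apply: dual_near => //; first by exists U.
  by move=> y [_ /VU].
exists ([set y | A y],
  [set eta : Gd | forall y, A y -> (@circle_val R @^-1` U) (eta y)]) => //.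
by move=> [y eta] /= [Ay]; apply.
Qed.

(** For a compact set A and an open set O, near-covering reduces the claim to the joint continuity
    of (y, xi) |-> zeta y * xi y at the points of A. *)
Lemma dual_addl_continuous (zeta : Gd) : continuous (fun xi : Gd => zeta + xi).
Proof.
move=> xi; apply/(dual_cvgP (fmap_filter _ (nbhs_filter xi)) (zeta + xi)).
move=> A O cA oO AO.
move/compact_near_coveringP: cA.
move=> /(_ Gd (nbhs xi) (fun eta y => O ((zeta + eta) y)) (nbhs_filter xi)) h.
suff : \forall eta \near nbhs xi, A `<=` (fun y => O ((zeta + eta) y)).
  by apply: filterS => eta /= H x Ax; exact: H.
apply: h => y Ay.
have cv : (fun p : G * Gd => (zeta p.1 * p.2 p.1)%g)
    @ filter_prod (nbhs y) (nbhs xi) --> (zeta y * xi y)%g.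
  apply: circle_mul_cvg.
    apply: (@cvg_comp _ _ _ fst (dual_val zeta)
      (filter_prod (nbhs y) (nbhs xi)) (nbhs y)).
      exact: cvg_fst.
    exact: char_continuous.
  move=> B; rewrite -[nbhs _ B]/(nbhs (xi y) B) (@nbhsE (circle R)).
  move=> -[U [oU Uxi] UB].
  have := dual_eval_near oU Uxi.
  by apply: (filterS (F := filter_prod (nbhs y) (nbhs xi))) => p; exact: UB.
apply: cv; apply: open_nbhs_nbhs; split => //.
exact: AO.
Qed.

Definition annihilator : set Gd := [set xi | forall x, K x -> xi x = 1%g].

(* A unimodular z <> 1 cannot have all its powers z ^ (2 ^ k) in the right half
   plane, since 1 - Re (z ^ 2) >= 2 * (1 - Re z) when Re z >= 0. *)
Lemma circle_no_small_subgroup (z : circle R) :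
  (forall k, 0 < complex.Re ((z ^+ (2 ^ k))%g : C)) -> z = 1%g.
Proof.
have norm1 (w : circle R) :
    complex.Re (w : C) ^+ 2 + complex.Im (w : C) ^+ 2 = 1.
  have := circle_valP w; rewrite cmodE => /eqP[]; rewrite /cmod.
  case: (w : C) => a b /= /(congr1 (fun x => x ^+ 2)).
  by rewrite sqr_sqrtr ?addr_ge0 ?sqr_ge0// expr1n.
have Re_sqr (w : circle R) :
    complex.Re ((w * w)%g : C) = 2 * complex.Re (w : C) ^+ 2 - 1.
  have := norm1 w; rewrite -[circle_val (w * w)%g]/((w : C) * w).
  by case: (w : C) => a b /=; lra.
move=> zk; pose c k := complex.Re ((z ^+ (2 ^ k))%g : C).
have cS k : c k.+1 = 2 * c k ^+ 2 - 1.
  by rewrite /c expnS mul2n -addnn expgnDr Re_sqr.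
have cd k : 2 ^+ k * (1 - c 0%N) <= 1 - c k.
  elim: k => [|k IH]; first by rewrite expr0 mul1r.
  rewrite exprS -mulrA; apply: (@le_trans _ _ (2 * (1 - c k))).
    by rewrite ler_pM2l.
  have ck0 : 0 < c k by exact: zk.
  have ck1 : c k ^+ 2 <= 1 by rewrite -(norm1 (z ^+ (2 ^ k))%g) lerDl sqr_ge0.
  by rewrite cS; nra.
have c01 : c 0%N = 1.
  have ck1 : c 0%N ^+ 2 <= 1 by rewrite -(norm1 (z ^+ (2 ^ 0))%g) lerDl sqr_ge0.
  have ck0 : 0 < c 0%N by exact: zk.
  apply/eqP; rewrite eq_le; apply/andP; split; first by nra.
  rewrite leNgt; apply/negP => c0.
  have d0 : 0 < 1 - c 0%N by rewrite subr_gt0.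
  (* Chosen so that 2^k (1 - c 0) > 1, which contradicts 1 - c k < 1. *)
  pose k := (Num.truncn (1 - c 0%N)^-1).+1.
  have : 1 < 2 ^+ k * (1 - c 0%N).
    rewrite -ltr_pdivrMr// div1r; apply: (@lt_le_trans _ _ k%:R).
      exact: truncnS_gt.
    by rewrite -natrX ler_nat ltnW// ltn_expl.
  have := cd k; have : 0 < c k by exact: zk.
  lra.
have Re1 : complex.Re (z : C) = 1 by move: c01; rewrite /c expn0 expg1.
have Im0 : complex.Im (z : C) = 0.
  apply/eqP; rewrite -sqrf_eq0; apply/eqP.
  by have := norm1 z; rewrite Re1 expr1n; lra.
by apply/val_inj/eqP; rewrite eq_complex Re1 Im0 !eqxx.
Qed.

(** A character close to an element of P maps the compact set K into the right half plane. Since K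
    is a subgroup, all powers of its values on K stay there as well, which forces these values to be
    1. *)
Lemma annihilator_open_subgroup : open_subgroup annihilator.
Proof.
split => //; last first.
  move=> xi eta Kxi Keta x Kx.
  by rewrite dual_add dual_opp Kxi// Keta// invg1 mulg1.
pose O : set (circle R) := [set z : circle R | 0 < complex.Re (z : C)].
have oO : open O.
  apply: (@open_comp _ _ (fun z : circle R => complex.Re (z : C))
    [set x : R | 0 < x]); last exact: open_gt.
  move=> z _; apply: (@cvg_comp _ _ _ (@circle_val R)
    (fun z : cplx R => complex.Re z) (nbhs z) (nbhs (z : cplx R))).
    exact: circle_val_continuous.
  exact: Re_continuous.
rewrite openE => xi Kxi.
have := @dual_near xi K O K_compact oO.
have h x : K x -> O (xi x) by move=> Kx; rewrite Kxi// /O/= ltr01.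
move=> /(_ h); apply: filterS => eta etaO x Kx.
apply: circle_no_small_subgroup => k.
have Kn n : K (x *+ n) /\ eta (x *+ n) = (eta x ^+ n)%g.
  elim: n => [|n [Kn En]].
    by rewrite mulr0n char0 expg0; split=> //; case: K_subgroup.
  by rewrite mulrSr expgSr charD En; split => //; exact: subgroupD.
by have [Kk Ek] := Kn (2 ^ k)%N; rewrite -Ek; exact: etaO.
Qed.

(* An ultrafilter on P converges pointwise to a homomorphism that is trivial on
   K, hence continuous; pointwise convergence is uniform on compact sets because
   all these characters are constant on the cosets of K. *)
Lemma annihilator_compact : compact annihilator.
Proof.
rewrite compact_ultra => F UF FP.
have := @circle_compact R; rewrite compact_ultra => cT.
have cvx (x : G) : exists z : circle R, (fun eta : Gd => eta x) @ F --> z.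
  have UG : UltraFilter ((fun eta : Gd => eta x) @ F) by exact: ultra_fmap.
  have [|z [_ Fz]] := cT _ UG; last by exists z.
  exact: filterT.
have [chi chiP] := choice cvx.
have FF : ProperFilter F by exact: ultra_proper.
have cvg_uniq (g : Gd -> circle R) (z w : circle R) :
    g @ F --> z -> g @ F --> w -> z = w.
  by move=> gz gw; exact: (cvg_unique (@circle_hausdorff R) gz gw).
have chiD x y : chi (x + y) = (chi x * chi y)%g.
  apply: cvg_uniq (chiP (x + y)) _.
  have -> : (fun eta : Gd => eta (x + y)) = (fun eta : Gd => (eta x * eta y)%g).
    by apply/funext => eta; rewrite charD.
  exact: (circle_mul_cvg _ (chiP x) (chiP y)).
have chiK x : K x -> chi x = 1%g.
  move=> Kx; apply: cvg_uniq (chiP x) _.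
  apply: cvg_near_cst.
  by apply: (filterS (F := F)) FP => eta; apply.
have chi_coset x y : coset K x y -> chi y = chi x.
  by move=> xy; rewrite -[y](subrK x) chiD chiK// mul1g.
have chi_cont : continuous chi.
  move=> x; apply: cvg_near_cst.
  have : nbhs x (coset K x).
    exact: (coset_nbhs topologicalZmod_addl_continuous).
  by apply: filterS => y; exact: chi_coset.
have chi_char : `[< is_character chi >] by apply/asboolP; split.
exists (Dual chi_char); split => //=.
apply/(dual_cvgP _ (Dual chi_char)) => A O cA oO AO /=.
move/compact_near_coveringP: cA.
move=> /(_ Gd F (fun eta y => O (eta y)) _) h.
suff : \forall eta \near F, A `<=` (fun y => O ((eta : Gd) y)).
  by apply: (filterS (F := F)) => eta /= H x Ax; exact: H.
apply: h => y Ay.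
have Fy : F [set eta : Gd | O (eta y)].
  by apply: chiP; apply: open_nbhs_nbhs; split => //; exact: AO.
exists (coset K y, [set eta : Gd | O (eta y)] `&` annihilator) => /=.
  split; last exact: filterI.
  exact: (coset_nbhs topologicalZmod_addl_continuous).
move=> [x eta] /= [xy [Oy etaK]].
by rewrite -[x](subrK y) charD etaK// mul1g.
Qed.

End dual_topology.

(** * Complex-valued measurable functions *)

Section complex_measurable.
Context d (T : measurableType d) (R : realType).
Local Notation C := R[i].
Implicit Types f g : T -> C.

Lemma ReD (z w : C) : complex.Re (z + w) = complex.Re z + complex.Re w.
Proof. by case: z w => ? ? [? ?]. Qed.

Lemma ImD (z w : C) : complex.Im (z + w) = complex.Im z + complex.Im w.
Proof. by case: z w => ? ? [? ?]. Qed.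

Lemma ReM (z w : C) : complex.Re (z * w) =
  complex.Re z * complex.Re w - complex.Im z * complex.Im w.
Proof. by case: z w => ? ? [? ?]. Qed.

Lemma ImM (z w : C) : complex.Im (z * w) =
  complex.Re z * complex.Im w + complex.Im z * complex.Re w.
Proof. by case: z w => ? ? [? ?]. Qed.

Lemma continuous_borel_real (U : topologicalType) (x0 : U) (f : U -> R) :
  continuous f -> measurable_fun setT (f : borel x0 -> R).
Proof.
move=> /continuousP cf; apply: (measurability _ (RGenOpens.measurableE R)).
move=> _ [_ [x [y ->]] <-]; rewrite setTI; apply: open_borel; apply: cf.
exact: interval_open.
Qed.

(** For the converse, an open set of C is the union of the countably many boxes with rational centre
    and radius 1/(n+1) that it contains. *)
Lemma cmeasurableP f : cmeasurable f <->
  measurable_fun setT (fun t => complex.Re (f t)) /\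
  measurable_fun setT (fun t => complex.Im (f t)).
Proof.
split=> [mf|[mRe mIm]].
  split.
    apply: (@measurableT_comp _ _ _ _ _ _
      (fun z : borel (0 : cplx R) => complex.Re (z : C))) => //.
    by apply: continuous_borel_real; exact: Re_continuous.
  apply: (@measurableT_comp _ _ _ _ _ _
    (fun z : borel (0 : cplx R) => complex.Im (z : C))) => //.
  by apply: continuous_borel_real; exact: Im_continuous.
apply: (@measurability _ _ T (borel (0 : cplx R)) setT f
  (@open (cplx R) : set (set (pointed_at (0 : cplx R))))) => //.
move=> _ [V oV <-]; rewrite setTI.
pose box (i : rat * rat * nat) : set C := [set z |
  `|complex.Re z - ratr i.1.1| < i.2.+1%:R^-1 /\
  `|complex.Im z - ratr i.1.2| < i.2.+1%:R^-1].
pose B i := if `[< box i `<=` V >] then f @^-1` box i else set0.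
have -> : f @^-1` V = \bigcup_i B i.
  apply/seteqP; split=> t; last first.
    by move=> [i _]; rewrite /B; case: asboolP => // iV /iV.
  move=> Vft.
  have : nbhs (f t : cplx R) (V : set (cplx R)) by apply: open_nbhs_nbhs.
  move=> /nbhs_normP[e /= e0 eV].
  have [e1 e1E e10] : exists2 e1 : R, e = e1%:C%C & 0 < e1.
    by case: e e0 {eV} => e1 e2; rewrite ltcE/= => /andP[/eqP -> e10];
      exists e1.
  (* In each coordinate, two points of one box differ by less than 2/(n+1), so their distance is
     below 4/(n+1) < e1. *)
  pose n := Num.truncn (4 / e1).
  have n0 : 0 < n.+1%:R^-1 :> R by rewrite invr_gt0.
  have ne : n.+1%:R^-1 *+ 4 < e1.
    rewrite -[_ *+ 4]mulr_natl ltr_pdivrMr// -ltr_pdivrMl// mulrC.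
    exact: truncnS_gt.
  have rat_near (x : R) : exists q : rat, `|x - ratr q| < n.+1%:R^-1.
    have : x - n.+1%:R^-1 < x + n.+1%:R^-1 by rewrite ltrD2l gtrN.
    move=> /rat_in_itvoo[q]; rewrite in_itv/= => /andP[xq qx].
    by exists q; rewrite distrC ltr_distl xq qx.
  have [q1 q1P] := rat_near (complex.Re (f t)).
  have [q2 q2P] := rat_near (complex.Im (f t)).
  exists (q1, q2, n) => //; rewrite /B ifT//; apply/asboolP => z.
  rewrite /box/= => -[z1 z2].
  apply: eV => /=; rewrite e1E cmodE ltcR.
  apply: le_lt_trans (cmod_le_ReIm _) _.
  have ReN (w : C) : complex.Re (- w) = - complex.Re w by case: w.
  have ImN (w : C) : complex.Im (- w) = - complex.Im w by case: w.
  rewrite ReD ImD ReN ImN; apply: lt_trans ne.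
  have := ler_distD (ratr q1) (complex.Re (f t)) (complex.Re z).
  have := ler_distD (ratr q2) (complex.Im (f t)) (complex.Im z).
  rewrite [`|ratr q1 - _|]distrC [`|ratr q2 - _|]distrC -[_ *+ 4]mulr_natl.
  move: q1P q2P z1 z2; set m := n.+1%:R^-1; move: m => m; lra.
apply: countable_bigcupT_measurable => // i; rewrite /B; case: asboolP => // _.
have -> : f @^-1` box i =
    (fun t => complex.Re (f t)) @^-1` ball (ratr i.1.1 : R) i.2.+1%:R^-1 `&`
    (fun t => complex.Im (f t)) @^-1` ball (ratr i.1.2 : R) i.2.+1%:R^-1.
  by apply/seteqP; split=> t /=; rewrite /ball/= ![`|ratr _ - _|]distrC.
by apply: measurableI; rewrite -[X in measurable X]setTI;
  [apply: mRe|apply: mIm] => //; exact: measurable_ball.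
Qed.

Lemma cmeasurable_continuous (U : topologicalType) (x0 : U) (f : U -> C) :
  continuous (f : U -> cplx R) -> @cmeasurable _ (borel x0) R f.
Proof. exact: continuous_borel. Qed.

Lemma cmeasurable_cst (c : C) : cmeasurable (fun _ : T => c).
Proof. exact: measurable_cst. Qed.

Lemma cmeasurableD f g : cmeasurable f -> cmeasurable g ->
  cmeasurable (fun t => f t + g t).
Proof.
move=> /cmeasurableP[fR fI] /cmeasurableP[gR gI]; apply/cmeasurableP.
under eq_fun do rewrite ReD.
under [X in _ /\ measurable_fun _ X]eq_fun do rewrite ImD.
by split; exact: measurable_funD.
Qed.

Lemma cmeasurableM f g : cmeasurable f -> cmeasurable g ->
  cmeasurable (fun t => f t * g t).
Proof.
move=> /cmeasurableP[fR fI] /cmeasurableP[gR gI]; apply/cmeasurableP.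
under eq_fun do rewrite ReM.
under [X in _ /\ measurable_fun _ X]eq_fun do rewrite ImM.
split; first by apply: measurable_funB; exact: measurable_funM.
by apply: measurable_funD; exact: measurable_funM.
Qed.

Lemma cmeasurable_conj f : cmeasurable f -> cmeasurable (fun t => conjc (f t)).
Proof.
move=> /cmeasurableP[fR fI]; apply/cmeasurableP.
have -> : (fun t => complex.Re (conjc (f t))) = (fun t => complex.Re (f t)).
  by apply/funext => t; case: (f t).
have -> : (fun t => complex.Im (conjc (f t))) = (fun t => - complex.Im (f t)).
  by apply/funext => t; case: (f t).
by split => //; exact: measurable_funN.
Qed.

Lemma cmeasurable_sum n (F : 'I_n -> T -> C) : (forall i, cmeasurable (F i)) ->
  cmeasurable (fun t => \sum_(i < n) F i t).
Proof.
elim: n F => [F _|n IH F mF].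
  by under eq_fun do rewrite big_ord0; exact: cmeasurable_cst.
under eq_fun do rewrite big_ord_recr; apply: cmeasurableD => //.
exact: IH.
Qed.

Lemma cmeasurable_indic (A : set T) : measurable A ->
  cmeasurable (fun t => (\1_A t : R)%:C%C).
Proof.
by move=> mA; apply/cmeasurableP; split => /=;
  [exact: measurable_indic|exact: measurable_cst].
Qed.

Lemma measurable_cmod f : cmeasurable f ->
  measurable_fun setT (fun t => cmod (f t)).
Proof.
move=> /cmeasurableP[mRe mIm].
have -> : (fun t => cmod (f t)) =
    Num.sqrt \o (fun t => complex.Re (f t) ^+ 2 + complex.Im (f t) ^+ 2).
  by apply/funext => t /=; rewrite /cmod; case: (f t).
apply: measurableT_comp.
  by apply: continuous_measurable_fun; exact: sqrt_continuous.
by apply: measurable_funD; exact: measurable_funX.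
Qed.

End complex_measurable.

Section complex_integral.
Context d (T : measurableType d) (R : realType).
Variable mu : {measure set T -> \bar R}.
Local Notation C := R[i].
Implicit Types f g : T -> C.

Lemma cintegrable_Re f : cintegrable mu f ->
  mu.-integrable setT (EFin \o (fun t => complex.Re (f t))).
Proof.
move=> [/[dup] mf /cmeasurableP[mRe _] foo].
apply/integrableP; split; first exact/measurable_EFinP.
apply: le_lt_trans foo; apply: le_integral_nonneg => t //=.
by rewrite lee_fin Re_le_cmod.
Qed.

Lemma cintegrable_Im f : cintegrable mu f ->
  mu.-integrable setT (EFin \o (fun t => complex.Im (f t))).
Proof.
move=> [/[dup] mf /cmeasurableP[_ mIm] foo].
apply/integrableP; split; first exact/measurable_EFinP.
apply: le_lt_trans foo; apply: le_integral_nonneg => t //=.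
by rewrite lee_fin Im_le_cmod.
Qed.

Lemma cmod_ge0 (z : C) : 0 <= cmod z.
Proof. by case: z => a b; exact: sqrtr_ge0. Qed.

Lemma cmodM (z w : C) : cmod (z * w) = cmod z * cmod w.
Proof. exact: ComplexField.Normc.normcM. Qed.

Lemma cmodD (z w : C) : cmod (z + w) <= cmod z + cmod w.
Proof. exact: le_normcD. Qed.

Lemma cmod_sum n (F : 'I_n -> C) :
  cmod (\sum_(i < n) F i) <= \sum_(i < n) cmod (F i).
Proof.
elim: n F => [F|n IH F].
  by rewrite !big_ord0 /cmod/= expr0n/= addr0 sqrtr0.
rewrite !big_ord_recr/=; apply: le_trans (cmodD _ _) _.
by rewrite lerD2r; exact: IH.
Qed.

Lemma cmod_real (a : R) : 0 <= a -> cmod (a%:C%C) = a.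
Proof. by move=> a0; rewrite /cmod/= expr0n/= addr0 sqrtr_sqr ger0_norm. Qed.

Lemma cintegrableD f g : cintegrable mu f -> cintegrable mu g ->
  cintegrable mu (fun t => f t + g t).
Proof.
move=> [mf foo] [mg goo]; split; first exact: cmeasurableD.
apply: (@le_lt_trans _ _ (\int[mu]_t ((cmod (f t))%:E + (cmod (g t))%:E))%E).
  apply: le_integral_nonneg => t; first by rewrite lee_fin cmod_ge0.
  by rewrite lee_fin cmodD.
rewrite ge0_integralD//; first by rewrite lte_add_pinfty.
- by move=> t _; rewrite lee_fin cmod_ge0.
- by apply/measurable_EFinP; exact: measurable_cmod.
- by move=> t _; rewrite lee_fin cmod_ge0.
- by apply/measurable_EFinP; exact: measurable_cmod.
Qed.

Lemma cintegrableZ (c : C) f : cintegrable mu f ->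
  cintegrable mu (fun t => c * f t).
Proof.
move=> [mf foo]; split; first by apply: cmeasurableM => //;
  exact: cmeasurable_cst.
under eq_integral do rewrite cmodM EFinM.
rewrite ge0_integralZl//; first by rewrite lte_mul_pinfty// lee_fin cmod_ge0.
- by apply/measurable_EFinP; exact: measurable_cmod.
- by move=> t _; rewrite lee_fin cmod_ge0.
- by rewrite lee_fin cmod_ge0.
Qed.

Lemma cintegralD f g : cintegrable mu f -> cintegrable mu g ->
  cintegral mu (fun t => f t + g t) = cintegral mu f + cintegral mu g.
Proof.
move=> if_ ig; rewrite /cintegral.
under eq_Rintegral do rewrite ReD.
under [X in Complex _ X = _]eq_Rintegral do rewrite ImD.
by rewrite !RintegralD//; do ?[exact: cintegrable_Re|exact: cintegrable_Im].
Qed.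

Lemma cintegralZ (c : C) f : cintegrable mu f ->
  cintegral mu (fun t => c * f t) = c * cintegral mu f.
Proof.
move=> if_; have iR := cintegrable_Re if_; have iI := cintegrable_Im if_.
rewrite /cintegral.
under eq_Rintegral do rewrite ReM.
under [X in Complex _ X = _]eq_Rintegral do rewrite ImM.
have iZ a (h : T -> R) : mu.-integrable setT (EFin \o h) ->
    mu.-integrable setT (EFin \o (fun t => a * h t)).
  by move=> ih; apply: eq_integrable (integrableZl measurableT a ih).
rewrite RintegralB ?RintegralD ?RintegralZl//; try exact: iZ.
by case: c.
Qed.

Lemma cintegral_sum n (F : 'I_n -> T -> C) : (forall i, cintegrable mu (F i)) ->
  cintegral mu (fun t => \sum_(i < n) F i t) = \sum_(i < n) cintegral mu (F i).
Proof.
(* Integrability of the partial sums is carried through the induction, as additivity of the integral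
   requires it. *)
move=> iF; suff [] : cintegrable mu (fun t => \sum_(i < n) F i t) /\
  cintegral mu (fun t => \sum_(i < n) F i t) =
    \sum_(i < n) cintegral mu (F i) by [].
elim: n F iF => [F _|n IH F iF].
  under eq_fun do rewrite big_ord0.
  rewrite big_ord0; split.
    split; first exact: cmeasurable_cst.
    by under eq_integral do rewrite cmod_real//; rewrite integral0.
  by rewrite /cintegral !Rintegral_cst//= !mul0r.
have [iS ES] := IH _ (fun i => iF (widen_ord (leqnSn n) i)).
under eq_fun do rewrite big_ord_recr.
split; first exact: cintegrableD.
by rewrite cintegralD// big_ord_recr ES.
Qed.

End complex_integral.

(** * Time-frequency shifts of the window *)

Lemma cintegral_preserving d d' (T1 : measurableType d) (T2 : measurableType d')
    (R : realType) (m1 : {measure set T1 -> \bar R})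
    (m2 : {measure set T2 -> \bar R}) (phi : T1 -> T2) (f : T2 -> R[i]) :
  measurable_fun setT phi ->
  (forall A, measurable A -> m1 (phi @^-1` A) = m2 A) ->
  cmeasurable f -> cintegral m1 (fun x => f (phi x)) = cintegral m2 f.
Proof.
move=> mphi pres /cmeasurableP[mRe mIm]; rewrite /cintegral /Rintegral.
have mR : measurable_fun setT (EFin \o (fun t => complex.Re (f t)))
  by exact/measurable_EFinP.
have mI : measurable_fun setT (EFin \o (fun t => complex.Im (f t)))
  by exact/measurable_EFinP.
congr (Complex (fine _) (fine _)).
  exact: (integral_preserving mphi pres mR).
exact: (integral_preserving mphi pres mI).
Qed.

Section circle_conj.
Context (R : realType).

Lemma cmod_circle (z : circle R) : cmod (z : R[i]) = 1.
Proof. by have := circle_valP z; rewrite cmodE => /eqP[]. Qed.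

Lemma conj_circle (z : circle R) :
  conjc (z : R[i]) = ((z^-1)%g : circle R) :> R[i].
Proof.
rewrite -[RHS]/((z : R[i])^-1); apply: (mulfI (circle_neq0 z)).
by rewrite mulfV ?circle_neq0// -sqr_normc cmodE cmod_circle expr1n.
Qed.

End circle_conj.

Section window.
Context (R : realType) (G : topologicalZmodType).
Local Notation C := R[i].
Local Notation Gd := (dual R G).
Variable K : set G.
Hypotheses (K_compact : compact K) (K_subgroup : open_subgroup K).
Variable mu : {sigma_finite_measure set (borel (0 : G)) -> \bar R}.
Hypothesis mu_haar : haar_measure +%R mu.
Local Notation P := (@annihilator R G K).
Let muK : R := fine (mu K).
Let addG := @topologicalZmod_addl_continuous G.

Let mcoset a : measurable (coset K a : set (borel (0 : G))).
Proof. by apply: open_borel; exact: (coset_open addG). Qed.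

Let muKE : mu K = muK%:E.
Proof.
rewrite fineK// ge0_fin_numE//; exact: (haar_compact_lty mu_haar K_compact).
Qed.

Let mu_coset a : mu (coset K a) = muK%:E.
Proof. by rewrite -muKE; exact: (haar_coset mu_haar K_subgroup). Qed.

Lemma indic_realE (T : Type) (A : set T) (t : T) :
  (\1_A t : C) = (\1_A t : R)%:C%C.
Proof. by rewrite !indicE rmorph_nat. Qed.

Lemma cmeasurable_char (zeta : Gd) :
  @cmeasurable _ (borel (0 : G)) R (fun y : G => zeta y : C).
Proof. by apply: cmeasurable_continuous; exact: char_val_continuous. Qed.

Lemma cintegrable_char_coset (zeta : Gd) (a : G) :
  cintegrable mu (fun y : borel (0 : G) => (zeta y : C) * \1_(coset K a) y).
Proof.
split.
  apply: cmeasurableM; first exact: cmeasurable_char.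
  have -> : \1_(coset K a) =
      (fun y : borel (0 : G) => (\1_(coset K a) y : R)%:C%C).
    by apply/funext => y; exact: indic_realE.
  exact: cmeasurable_indic.
under eq_integral do rewrite cmodM cmod_circle mul1r indic_realE cmod_real//.
rewrite integral_indic// setIT; have := mu_coset a => /= ->.
exact: ltry.
Qed.

Lemma cintegral_coset (a : G) :
  cintegral mu (fun y : borel (0 : G) => \1_(coset K a) y : C) = muK%:C%C.
Proof.
rewrite /cintegral.
under eq_Rintegral do rewrite indic_realE /=.
under [X in Complex _ X = _]eq_Rintegral do rewrite indic_realE /=.
congr Complex; last by rewrite Rintegral_cst//= mul0r.
by rewrite /Rintegral integral_indic// setIT; have := mu_coset a => /= ->.
Qed.

(* If zeta k <> 1 for some k in K, translating by k multiplies the integral by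
   zeta k. *)
Lemma cintegral_char_coset (zeta : Gd) (a : G) :
  cintegral mu (fun y : borel (0 : G) => (zeta y : C) * \1_(coset K a) y) =
  \1_P zeta * ((zeta a : C) * muK%:C%C).
Proof.
have [zP|zP] := pselect (P zeta).
  rewrite indicE mem_set// mul1r -(cintegral_coset a) -cintegralZ; last first.
    have := cintegrable_char_coset 0 a.
    by under eq_fun do rewrite dual_zero mul1r.
  congr (cintegral mu _); apply/funext => y.
  have [ya|ya] := pselect (coset K a y);
    last by rewrite indicE memNset// !mulr0.
  by rewrite -[y in zeta y](subrK a) charD zP// mul1g.
rewrite indicE memNset// mul0r.
have [k [Kk zk]] : exists k, K k /\ zeta k <> 1%g.
  apply: contrapT => /forallNP h; apply: zP => x Kx; apply: contrapT => zx.
  exact: (h x).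
set F := fun y : borel (0 : G) => (zeta y : C) * \1_(coset K a) y.
have iF : cintegrable mu F := cintegrable_char_coset zeta a.
have : cintegral mu (fun y => F (y + k)) = cintegral mu F.
  apply: (@cintegral_preserving _ _ (borel (0 : G)) (borel (0 : G)) R mu mu
    (fun y => y + k)).
  - exact: measurable_addr addG k.
  - by move=> A mA; exact: (haar_addr mu_haar k mA).
  - exact: iF.1.
have -> : (fun y : borel (0 : G) => F (y + k)) = (fun y => (zeta k : C) * F y).
  apply/funext => y; rewrite /F charD mulrA [(zeta k : C) * _]mulrC;
    congr (_ * _).
  rewrite !indicE; congr (_%:R); congr nat_of_bool; apply/idP/idP;
    rewrite !inE /coset/=.
    by move=> h; rewrite -[y](addrK k) addrAC; case: K_subgroup => _ _; apply.
  by move=> h; rewrite addrAC; exact: subgroupD.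
rewrite cintegralZ// => /eqP.
rewrite -subr_eq0 -[X in _ - X]mul1r -mulrBl mulf_eq0.
move=> /orP[|/eqP//]; rewrite subr_eq0 => /eqP zk1.
by exfalso; apply: zk; apply/val_inj.
Qed.

Local Notation phi := (gaussian R K).

(** The two factors live on the cosets of u.1 and of z.1 + w.1. These are disjoint or equal, and
    equal exactly when z.1 lies in the coset of u.1 - w.1. The phases merge into one character of y,
    which leaves the integral of a character over a coset. *)
Lemma tfshift_mul_conj (u w z : G * Gd) (y : G) :
  tfshift u phi y * conjc (tfshift z (tfshift w phi) y) =
  ((w.2 z.1 : circle R) : C) * \1_(coset K (u.1 - w.1)) z.1 *
    (((u.2 - w.2 - z.2) y : C) * \1_(coset K u.1) y).
Proof.
case: u w z => [a al] [b be] [x xi] /=.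
rewrite /tfshift /modulation /translation /pairing /=.
rewrite -[phi (y - a)]/(\1_(coset K a) y : C).
rewrite !rmorphM/= !conj_circle.
have -> : conjc (phi (y - x - b)) = \1_(coset K (x + b)) y.
  rewrite /gaussian indicE rmorph_nat indicE; congr (_%:R).
  by congr nat_of_bool; apply/idP/idP; rewrite !inE /coset/= opprD addrA.
have yK : (\1_(coset K a) y : C) * \1_(coset K (x + b)) y =
    \1_(coset K (a - b)) x * \1_(coset K a) y.
  have [ya|ya] := pselect (coset K a y); last first.
    rewrite [X in X * _]indicE memNset// mul0r.
    by rewrite [X in _ * X]indicE memNset// mulr0.
  rewrite mulrC; congr (_ * _); rewrite !indicE; congr (_%:R);
    congr nat_of_bool.
  have yx : y - (x + b) = (y - a) - (x - (a - b)).
    by rewrite opprB [RHS]addrA [X in _ = X - x]addrA subrK opprD addrA addrAC.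
  apply/idP/idP; rewrite !inE /coset/= yx => h.
    have -> : x - (a - b) = (y - a) - (y - a - (x - (a - b))).
      by rewrite subKr.
    by case: K_subgroup => _ _; apply.
  by case: K_subgroup => _ _; apply.
have circleVE (t : circle R) : ((t^-1)%g : circle R) = (t : C)^-1 :> C by [].
have circleME (s t : circle R) : ((s * t)%g : circle R) = (s : C) * t :> C.
  by [].
rewrite charD charN !(circleVE, circleME) invfM invrK.
transitivity ((be x : C) * ((al y : C) * (be y : C)^-1 * (xi y : C)^-1) *
  ((\1_(coset K a) y : C) * \1_(coset K (x + b)) y)); first by ring.
by rewrite yK; ring.
Qed.

End window.

Section test_functions.
Context (R : realType) (G : topologicalZmodType).
Local Notation C := R[i].
Local Notation Gd := (dual R G).
Hypothesis G_hausdorff : hausdorff_space G.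
Variable K : set G.
Hypotheses (K_compact : compact K) (K_subgroup : open_subgroup K).
Variables (mu : {sigma_finite_measure set (borel (0 : G)) -> \bar R})
  (nu : {sigma_finite_measure set (borel (0 : Gd)) -> \bar R}).
Hypotheses (mu_haar : haar_measure +%R mu) (nu_haar : haar_measure +%R nu).
Variable v : G * Gd -> R.
Hypothesis v_admissible : admissible_weight v.
Local Notation P := (@annihilator R G K).
Local Notation phi := (gaussian R K).
Local Notation GGd := (borel (0 : G) * borel (0 : Gd))%type.
Let muK : R := fine (mu K).
Let addG := @topologicalZmod_addl_continuous G.
Let addGd := @dual_addl_continuous R G K K_compact K_subgroup.
Let P_subgroup := @annihilator_open_subgroup R G K K_compact K_subgroup.
Let P_compact := @annihilator_compact R G K K_subgroup.

Let muK_ge0 : 0 <= muK. Proof. exact: fine_ge0. Qed.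

(** The restrictions of v to the two factors are again submultiplicative and even, hence bounded on
    the compact open subgroups K and P, and v (k, eta) <= v (k, 0) * v (0, eta). *)
Lemma weight_bounded : exists2 M : R, 0 < M &
  forall k eta, K k -> P eta -> v (k, eta) <= M.
Proof.
case: v_admissible => -[mv v0] vD vN _ _.
have vge0 z : 0 <= v z by exact: ltW.
have vD1 x y : v (x + y, 0) <= v (x, 0) * v (y, 0).
  by have := vD (x, 0) (y, 0); rewrite -[(x, 0) + (y, 0)]/(x + y, 0 + 0) addr0.
have vD2 x y : v (0, x + y) <= v (0, x) * v (0, y).
  by have := vD (0, x) (0, y); rewrite -[(0, x) + (0, y)]/(0 + 0, x + y) addr0.
have vN1 x : v (- x, 0) = v (x, 0).
  by have := vN (x, 0); rewrite -[- (x, 0)]/(- x, - 0) oppr0.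
have vN2 x : v (0, - x) = v (0, x).
  by have := vN (0, x); rewrite -[- (0, x)]/(- 0, - x) oppr0.
have [M1 M10 vM1] := submultiplicative_bounded addG G_hausdorff mu_haar
  K_compact K_subgroup (measurable_fun_pair1 (0 : borel (0 : Gd)) mv)
  (fun x => vge0 (x, 0)) vD1 vN1.
have [M2 M20 vM2] := submultiplicative_bounded addGd (@dual_hausdorff R G)
  nu_haar P_compact P_subgroup (measurable_fun_pair2 (0 : borel (0 : G)) mv)
  (fun x => vge0 (0, x)) vD2 vN2.
exists (M1 * M2); first exact: mulr_gt0.
move=> k eta Kk Peta.
have -> : (k, eta) = (k, 0) + (0, eta) :> G * Gd.
  by congr pair; rewrite /= ?addr0 ?add0r.
by apply: le_trans (vD _ _) _; apply: ler_pM => //; [exact: vM1|exact: vM2].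
Qed.

Definition stft_support (u w : G * Gd) : set GGd :=
  coset K (u.1 - w.1) `*` coset P (u.2 - w.2).

Lemma measurable_stft_support u w : measurable (stft_support u w).
Proof.
by apply: measurableX; apply: open_borel;
  [exact: (coset_open addG)|exact: (coset_open addGd)].
Qed.

Lemma cintegrable_tfshift_mul_conj (u w z : G * Gd) :
  cintegrable mu (fun y : borel (0 : G) =>
    tfshift u phi y * conjc (tfshift z (tfshift w phi) y)).
Proof.
under eq_fun do rewrite (tfshift_mul_conj K_subgroup).
apply: cintegrableZ.
exact: (cintegrable_char_coset K_compact K_subgroup mu_haar).
Qed.

(** A character integrates to zero over a coset of K unless it belongs to P. Up to unimodular
    factors, the transform is therefore mu K times the indicator of a single coset of K x P. *)
Lemma stft_tfshift (u w z : G * Gd) :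
  stft mu (tfshift w phi) (tfshift u phi) z =
  (w.2 z.1 : C) * (((u.2 - w.2) u.1 : C) * muK%:C%C) * conjc (z.2 u.1 : C) *
    (\1_(stft_support u w) z : R)%:C%C.
Proof.
rewrite /stft.
under [X in cintegral _ X]eq_fun do rewrite (tfshift_mul_conj K_subgroup).
rewrite cintegralZ; last first.
  exact: (cintegrable_char_coset K_compact K_subgroup mu_haar).
rewrite (cintegral_char_coset K_compact K_subgroup mu_haar) -/muK.
have -> : ((u.2 - w.2 - z.2) u.1 : C) =
    ((u.2 - w.2) u.1 : C) * conjc (z.2 u.1 : C).
  by rewrite conj_circle.
have -> : \1_P (u.2 - w.2 - z.2) = \1_(coset P (u.2 - w.2)) z.2 :> C.
  rewrite !indicE; congr (_%:R); congr nat_of_bool; apply/idP/idP;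
    rewrite !inE => h.
    by rewrite /coset/= -opprB; exact: (subgroupN P_subgroup).
  by rewrite -opprB; exact: (subgroupN P_subgroup).
have -> : (\1_(stft_support u w) z : R)%:C%C =
    \1_(coset K (u.1 - w.1)) z.1 * \1_(coset P (u.2 - w.2)) z.2 :> C.
  rewrite -indic_realE !indicE -natrM mulnb; congr (_%:R); congr nat_of_bool.
  by rewrite /stft_support in_setX.
by ring.
Qed.

Lemma stft_span (n : nat) (c : 'I_n -> C) (w : 'I_n -> G * Gd) (u : G * Gd) :
  stft mu (fun y => \sum_(i < n) c i * tfshift (w i) phi y) (tfshift u phi) =
  (fun z => \sum_(i < n)
     conjc (c i) * stft mu (tfshift (w i) phi) (tfshift u phi) z).
Proof.
apply/funext => z; rewrite /stft.
have E (y : G) : tfshift u phi y *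
    conjc (tfshift z (fun y => \sum_(i < n) c i * tfshift (w i) phi y) y) =
    \sum_(i < n) conjc (c i) *
      (tfshift u phi y * conjc (tfshift z (tfshift (w i) phi) y)).
  have -> : tfshift z (fun y => \sum_(i < n) c i * tfshift (w i) phi y) y =
      \sum_(i < n) c i * tfshift z (tfshift (w i) phi) y.
    by rewrite [LHS]mulr_sumr; apply: eq_bigr => i _; rewrite mulrCA.
  rewrite rmorph_sum mulr_sumr; apply: eq_bigr => i _.
  by rewrite rmorphM mulrCA.
under [X in cintegral _ X]eq_fun do rewrite E.
rewrite cintegral_sum; last first.
  by move=> i; apply: cintegrableZ; exact: cintegrable_tfshift_mul_conj.
apply: eq_bigr => i _; rewrite cintegralZ//.
exact: cintegrable_tfshift_mul_conj.
Qed.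

Lemma cmeasurable_stft_tfshift (u w : G * Gd) :
  cmeasurable (stft mu (tfshift w phi) (tfshift u phi) : GGd -> C).
Proof.
rewrite (_ : stft _ _ _ = fun z : GGd => (w.2 z.1 : C) *
    (((u.2 - w.2) u.1 : C) * muK%:C%C) * conjc (z.2 u.1 : C) *
    (\1_(stft_support u w) z : R)%:C%C); last first.
  by apply/funext => z; exact: stft_tfshift.
apply: cmeasurableM; last by apply: cmeasurable_indic;
  exact: measurable_stft_support.
apply: cmeasurableM.
  apply: cmeasurableM; last exact: cmeasurable_cst.
  by apply: (measurableT_comp (@cmeasurable_char R G w.2));
    exact: measurable_fst.
apply: cmeasurable_conj.
apply: (@measurableT_comp _ _ _ _ _ _
  (fun xi : borel (0 : Gd) => (xi u.1 : C) : borel (0 : cplx R))).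
  apply: cmeasurable_continuous => xi.
  exact: ((circle_cvgP (nbhs_filter xi) (fun eta : Gd => eta u.1) (xi u.1)).1
    (@dual_eval_continuous R G u.1 xi)).
exact: measurable_snd.
Qed.

Lemma weight_stft_support (u w : G * Gd) :
  exists2 M : R, 0 <= M & forall z, stft_support u w z -> v z <= M.
Proof.
have [M M0 vM] := weight_bounded.
case: v_admissible => -[_ v0] vD _ _ _.
exists (v (u.1 - w.1, u.2 - w.2) * M) => [|[x xi] [/= Kx Pxi]].
  by rewrite mulr_ge0// ltW.
have -> : (x, xi) =
    (u.1 - w.1, u.2 - w.2) + (x - (u.1 - w.1), xi - (u.2 - w.2)).
  by congr pair; rewrite /= addrC subrK.
apply: le_trans (vD _ _) _; rewrite ler_pM2l//.
exact: vM.
Qed.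

Lemma stft_support_lty (u w : G * Gd) :
  ((mu \x nu)%E (stft_support u w) < +oo)%E.
Proof.
rewrite product_measure1E; [|by apply: open_borel; exact: (coset_open addG)
                            |by apply: open_borel; exact: (coset_open addGd)].
have := haar_coset mu_haar K_subgroup (u.1 - w.1) => /= ->.
have := haar_coset nu_haar P_subgroup (u.2 - w.2) => /= ->.
by rewrite lte_mul_pinfty ?ge0_fin_numE ?(haar_compact_lty mu_haar K_compact)
  ?(haar_compact_lty nu_haar P_compact).
Qed.

Lemma tfshift_test_space (g0 : G -> C) (u : G * Gd) :
  special_test_functions K g0 -> test_space mu nu v g0 (tfshift u phi).
Proof.
move=> [n [c [w ->]]]; split.
- split.
    exact: (cintegrable_char_coset K_compact K_subgroup mu_haar u.2 u.1).1.
  have E (y : G) : cmod (tfshift u phi y) ^+ 2 = \1_(coset K u.1) y.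
    rewrite -[tfshift u phi y]/((u.2 y : C) * \1_(coset K u.1) y).
    rewrite cmodM cmod_circle mul1r indic_realE cmod_real//.
    by rewrite indicE; case: (_ \in _); rewrite ?expr1n ?expr0n.
  under eq_integral do rewrite E.
  rewrite integral_indic//; last by apply: open_borel; exact: (coset_open addG).
  rewrite setIT; have := haar_coset mu_haar K_subgroup u.1 => /= ->.
  exact: (haar_compact_lty mu_haar K_compact).
- rewrite stft_span; apply: cmeasurable_sum => i; apply: cmeasurableM.
    exact: cmeasurable_cst.
  exact: cmeasurable_stft_tfshift.
rewrite /test_norm /L1v_norm stft_span.
have bnd i : exists M, 0 <= M /\ forall z, stft_support u (w i) z -> v z <= M.
  by have [M] := weight_stft_support u (w i); exists M.
have [M /all_and2[M0 vM]] := choice bnd.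
case: (v_admissible) => -[_ v0] _ _ _ _.
(* On the i-th support, [muK] is the modulus of the transform of the i-th shift and [M i] bounds the
   weight; outside it the term vanishes. *)
pose a i := cmod (c i) * muK * M i.
have a0 i : 0 <= a i by rewrite !mulr_ge0// cmod_ge0.
apply: (@le_lt_trans _ _ (\int[(mu \x nu)%E]_z
  \sum_(i < n) ((a i)%:E * (\1_(stft_support u (w i)) z)%:E))%E).
  apply: le_integral_nonneg => z.
    by rewrite lee_fin mulr_ge0 ?cmod_ge0// ltW.
  have -> : (\sum_(i < n) ((a i)%:E * (\1_(stft_support u (w i)) z)%:E))%E =
      (\sum_(i < n) a i * \1_(stft_support u (w i)) z)%:E.
    by rewrite -sumEFin; apply: eq_bigr => i _; rewrite EFinM.
  rewrite lee_fin.
  apply: (@le_trans _ _ ((\sum_(i < n) cmod (conjc (c i) *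
      stft mu (tfshift (w i) phi) (tfshift u phi) z)) * v z)).
    by apply: ler_wpM2r; [exact: ltW|exact: cmod_sum].
  rewrite mulr_suml; apply: ler_sum => i _.
  rewrite stft_tfshift !cmodM !cmod_circle conj_circle cmod_circle
    !cmod_real// !mul1r mulr1.
  have -> : cmod (conjc (c i)) = cmod (c i).
    by rewrite /cmod; case: (c i) => x y /=; rewrite sqrrN.
  rewrite /a indicE; have [zi|zi] := boolP (z \in _);
    last by rewrite !mulr0 mul0r.
  rewrite !mulr1 ler_wpM2l ?mulr_ge0 ?cmod_ge0//; apply: vM.
  by move: zi; rewrite inE.
rewrite ge0_integral_sum//; last 2 first.
- move=> i; apply: measurable_funeM; apply/measurable_EFinP;
  apply: measurable_indic.
  exact: measurable_stft_support.
- by move=> i z _; rewrite mule_ge0// lee_fin.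
apply: lte_sum_pinfty => i _.
rewrite ge0_integralZl//; last 2 first.
- by apply/measurable_EFinP; apply: measurable_indic;
  exact: measurable_stft_support.
- by rewrite lee_fin.
rewrite integral_indic//; last exact: measurable_stft_support.
by rewrite setIT lte_mul_pinfty// ?lee_fin//; exact: stft_support_lty.
Qed.

End test_functions.

(** * The maximal function of the short-time Fourier transform *)

Lemma countable_bigcup_measurable d (T : measurableType d) (U : Type)
    (D : set U) (F : U -> set T) :
  countable D -> (forall i, measurable (F i)) ->
  measurable (\bigcup_(i in D) F i).
Proof.
move=> cD mF; rewrite bigcup_set_type.
apply: countable_bigcupT_measurable => //.
by rewrite (eq_countable (card_setT _)).
Qed.

(** The pushforward of the product measure agrees with it on rectangles, so uniqueness of the
    product measure applies. It is used to translate frequencies while the circle variable stays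
    fixed. *)
Lemma product_measure_preserving1 d1 d2 (T1 : measurableType d1)
    (T2 : measurableType d2) (R : realType)
    (m1 : {sigma_finite_measure set T1 -> \bar R})
    (m2 : {sigma_finite_measure set T2 -> \bar R}) (phi : T1 -> T1) :
  measurable_fun setT phi ->
  (forall A, measurable A -> m1 (phi @^-1` A) = m1 A) ->
  let psi := fun z : T1 * T2 => (phi z.1, z.2) in
  measurable_fun setT psi /\
  forall A, measurable A -> (m1 \x m2)%E (psi @^-1` A) = (m1 \x m2)%E A.
Proof.
move=> mphi pres psi.
have mpsi : measurable_fun setT psi.
  apply: measurable_fun_pair; last exact: measurable_snd.
  exact: measurableT_comp mphi measurable_fst.
split=> // A mA.
pose psi_mixin := isMeasurableFun.Build _ _ _ _ psi mpsi.
pose psi_pack : {mfun _ >-> _} := HB.pack psi psi_mixin.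
apply/esym; apply: (@product_measure_unique _ _ _ _ _ m1 m2
  (pushforward (m1 \x m2)%E psi_pack)) => //.
move=> B1 B2 mB1 mB2; rewrite -(pres _ mB1) -product_measure1E//.
by rewrite -[X in measurable X]setTI; exact: mphi.
Qed.

Section main.
Context (R : realType) (G : topologicalZmodType).
Local Notation C := R[i].
Local Notation Gd := (dual R G).
Hypothesis G_hausdorff : hausdorff_space G.
Variable K : set G.
Hypotheses (K_compact : compact K) (K_subgroup : open_subgroup K).
Variables (mu : {sigma_finite_measure set (borel (0 : G)) -> \bar R})
  (nu : {sigma_finite_measure set (borel (0 : Gd)) -> \bar R}).
Hypotheses (mu_haar : haar_measure +%R mu) (nu_haar : haar_measure +%R nu).
Local Notation P := (@annihilator R G K).
Local Notation phi := (gaussian R K).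
Local Notation GGd := (borel (0 : G) * borel (0 : Gd))%type.
Let addG := @topologicalZmod_addl_continuous G.
Let addGd := @dual_addl_continuous R G K K_compact K_subgroup.
Let P_subgroup := @annihilator_open_subgroup R G K K_compact K_subgroup.
Let Gd_hausdorff := @dual_hausdorff R G.

Lemma precompact_finite_cosets (Q : set (heisenberg R G)) :
  precompact Q -> Q (heis_one R G) ->
  exists (n : nat) (zs : 'I_n.+1 -> G * Gd), forall k, Q k ->
    exists i, coset K (zs i).1 k.1.1 /\ coset P (zs i).2 k.1.2.
Proof.
move=> [B QB [cB _]] Q1.
have cB1 : compact ((fun k : heisenberg R G => k.1.1) @` B).
  apply: continuous_compact => //; apply: continuous_subspaceT => k.
  apply: (@cvg_comp _ _ _ (fst : heisenberg R G -> G * Gd) fst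
    (nbhs k) (nbhs k.1)).
    exact: cvg_fst.
  exact: cvg_fst.
have cB2 : compact ((fun k : heisenberg R G => k.1.2) @` B).
  apply: continuous_compact => //; apply: continuous_subspaceT => k.
  apply: (@cvg_comp _ _ _ (fst : heisenberg R G -> G * Gd) snd
    (nbhs k) (nbhs k.1)).
    exact: cvg_fst.
  exact: cvg_snd.
have [s1 s1P] := compact_finite_cosets addG K_subgroup cB1.
have [s2 s2P] := compact_finite_cosets addGd P_subgroup cB2.
pose s := [seq (a, b) | a <- s1, b <- s2].
have Qs k : Q k -> exists i : nat, (i < size s)%N /\
    (coset K (nth 0 s i).1 k.1.1 /\ coset P (nth 0 s i).2 k.1.2).
  move=> Qk; have Bk : B k by exact: QB.
  have [a as1 ak] : exists2 a, a \in s1 & coset K a k.1.1.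
    by apply: s1P; exists k.
  have [b bs2 bk] : exists2 b, b \in s2 & coset P b k.1.2.
    by apply: s2P; exists k.
  have abs : (a, b) \in s by apply: allpairs_f.
  by exists (index (a, b) s); rewrite index_mem nth_index.
(* The unit of the group lies in Q, so the list is nonempty and can be indexed by ['I_n.+1], where
   maxima exist. *)
have [i0 [i0s _]] := Qs _ Q1.
have sE : (size s).-1.+1 = size s by rewrite prednK//; exact: leq_trans i0s.
exists (size s).-1, (fun i => nth 0 s i) => k /Qs[i [si ki]].
have si' : (i < (size s).-1.+1)%N by rewrite sE.
by exists (Ordinal si').
Qed.

(** The preimage of any set is a union of cosets of K x P, of which there are only countably many.
    This yields measurability of |V_phi f| although f is an abstract functional. *)
Lemma coset_invariant_measurable (N : G * Gd -> R) :
  (forall x x' xi xi', coset K x x' -> coset P xi xi' ->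
     N (x', xi') = N (x, xi)) ->
  measurable_fun setT (N : GGd -> R).
Proof.
move=> NE _ Y mY; rewrite setTI.
have [D1 cD1 D1P] := countable_cosets addG G_hausdorff mu_haar K_subgroup.
have [D2 cD2 D2P] := countable_cosets addGd Gd_hausdorff nu_haar P_subgroup.
have -> : N @^-1` Y = \bigcup_(ab in D1 `*` D2)
    (if `[< Y (N ab) >] then coset K ab.1 `*` coset P ab.2 else set0).
  apply/seteqP; split=> [[x xi] /= YN|[x xi] [[a b] _]]; last first.
    by case: asboolP => //= YN [ax bxi]; rewrite (NE a x b xi).
  have [a D1a ax] := D1P x; have [b D2b bxi] := D2P xi.
  by exists (a, b) => //; rewrite -(NE a x b xi ax bxi) ifT//; apply/asboolP.
apply: countable_bigcup_measurable; first exact: countableX.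
move=> ab; case: ifP => _ //.
by apply: measurableX; apply: open_borel;
  [exact: (coset_open addG)|exact: (coset_open addGd)].
Qed.

Section wavelet.
Variables (v : G * Gd -> R) (g0 : G -> C).
Hypotheses (v_admissible : admissible_weight v)
  (g0_test : special_test_functions K g0).
Variable f : (G -> C) -> C.
Hypothesis f_reservoir : reservoir mu nu v g0 f.

Definition gaussian_stft_norm (z : G * Gd) : R := cmod (f (tfshift z phi)).

(* Antilinearity is only available for a * h + k with k in the test space, hence
   the decomposition a * h = (a - 1) * h + h. *)
Lemma reservoir_scale (a : C) (z : G * Gd) :
  f (fun y => a * tfshift z phi y) = conjc a * f (tfshift z phi).
Proof.
have hz : test_space mu nu v g0 (tfshift z phi) by exact: tfshift_test_space.
have [flin _] := f_reservoir.
have := flin (a - 1) _ _ hz hz.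
rewrite (_ : (fun y => _) = (fun y => a * tfshift z phi y)); last first.
  by apply/funext => y; rewrite mulrBl mul1r subrK.
by move=> ->; rewrite rmorphB rmorph1 mulrBl mul1r subrK.
Qed.

Lemma cmod_wavelet (h : heisenberg R G) :
  cmod (wavelet phi f h) = gaussian_stft_norm h.1.
Proof.
by rewrite /wavelet reservoir_scale cmodM conj_circle cmod_circle mul1r.
Qed.

(* Translating by K does not change phi, and modulating by a character that is
   trivial on K only multiplies each translate of phi by a scalar. *)
Lemma gaussian_stft_norm_coset x x' xi xi' : coset K x x' -> coset P xi xi' ->
  gaussian_stft_norm (x', xi') = gaussian_stft_norm (x, xi).
Proof.
move=> xx' xixi'; rewrite /gaussian_stft_norm.
have -> : tfshift (x', xi') phi =
    (fun y => ((xi' - xi) x : C) * tfshift (x, xi) phi y).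
  apply/funext => y.
  rewrite -[LHS]/((xi' y : C) * \1_(coset K x') y) -(coset_eq K_subgroup xx').
  rewrite -[tfshift _ _ y]/((xi y : C) * \1_(coset K x) y).
  have [yx|yx] := pselect (coset K x y);
    last by rewrite indicE memNset// !mulr0.
  rewrite mulrA; congr (_ * _).
  have -> : (xi' - xi) x = (xi' - xi) y.
    by rewrite -[y in RHS](subrK x) charD (xixi' _ yx) mul1g.
  rewrite -[((xi' - xi) y : C)]/((xi' y : C) * (xi y : C)^-1).
  by rewrite divfK// circle_neq0.
by rewrite reservoir_scale cmodM conj_circle cmod_circle mul1r.
Qed.

End wavelet.
End main.

(** * Mixed norms of functions dominated by finitely many translates *)

Section mixed_norm_bound.
Context (R : realType) (G : topologicalZmodType).
Local Notation C := R[i].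
Local Notation Gd := (dual R G).
Local Notation GGd := (borel (0 : G) * borel (0 : Gd))%type.
Hypothesis addGd : forall zeta : Gd, continuous (fun xi : Gd => zeta + xi).
Variables (mu : {sigma_finite_measure set (borel (0 : G)) -> \bar R})
  (nu : {sigma_finite_measure set (borel (0 : Gd)) -> \bar R})
  (lam : {sigma_finite_measure set (borel (1%g : circle R)) -> \bar R}).
Hypotheses (mu_haar : haar_measure +%R mu) (nu_haar : haar_measure +%R nu).
Let addG := @topologicalZmod_addl_continuous G.

(** The weight is moved along with N by m z <= k * m (z + zs i), so that the weighted function is
    dominated by translates of the single function N m. The translations are then removed by
    invariance of mu in the inner norm and of nu in the outer one. *)
Lemma mixed_norm_le_translates (p q : \bar R) (n : nat)
    (zs : 'I_n.+1 -> G * Gd) (k : R) : (0 < p)%E -> (0 < q)%E -> 0 <= k ->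
  exists2 c : R, 0 < c & forall (N m : G * Gd -> R)
    (F : heisenberg R G -> C) (M : heisenberg R G -> \bar R),
    (forall z, 0 <= N z) -> (forall z, 0 < m z) ->
    measurable_fun setT (N : GGd -> R) -> measurable_fun setT (m : GGd -> R) ->
    (forall h, cmod (F h) = N h.1) ->
    (forall h, exists i, (`|M h| <= (N (h.1 + zs i)%R)%:E)%E) ->
    (forall i z, m z <= k * m (z + zs i)) ->
    (mixed_norm mu nu lam p q m M <=
     (c * k)%:E * Lpq_norm mu nu lam p q m F)%E.
Proof.
move=> p0 q0 k0.
have [cp cp0 cpP] := @le_Lnorm_finite_sup _ (borel (0 : G)) R mu n p p0.
have [cq cq0 cqP] := @le_Lnorm_finite_sup _
  (borel (0 : Gd) * borel (1%g : circle R))%type R (nu \x lam)%E n q q0.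
exists (cq * cp); first exact: mulr_gt0.
move=> N m F M N0 m0 mN mm FN MN mk.
pose Gf (z : GGd) : \bar R := (N z * m z)%:E.
have Gf0 z : (0 <= Gf z)%E by rewrite lee_fin mulr_ge0// ltW.
have mGf : measurable_fun setT Gf.
  by apply/measurable_EFinP; exact: measurable_funM.
pose H (xi : borel (0 : Gd)) : \bar R := Lnorm mu p (fun x => Gf (x, xi)).
have mH : measurable_fun setT H by exact: measurable_Lnorm.
have H0 xi : (0 <= H xi)%E by exact: Lnorm_ge0.
pose M1 (w : borel (0 : Gd) * borel (1%g : circle R)) : \bar R :=
  Lnorm mu p (fun x : borel (0 : G) =>
    (`|M ((x, w.1), w.2)| * (m (x, w.1))%:E)%E).
pose ta (a : G) (x : borel (0 : G)) : borel (0 : G) := (x : G) + a.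
pose tb (b : Gd) (xi : borel (0 : Gd)) : borel (0 : Gd) := (xi : Gd) + b.
(* The index depends on w, hence the inner norms are again dominated only by a finite family of
   translates, to which the outer bound applies with [cp * k] in place of k. *)
have inner w : exists i, (`|M1 w| <= (cp * k)%:E * H (tb (zs i).2 w.1))%E.
  have [||t|i iP] := cpP (fun i x => Gf (ta (zs i).1 x, tb (zs i).2 w.1))
      (fun x : borel (0 : G) => (`|M ((x, w.1), w.2)| * (m (x, w.1))%:E)%E)
      k k0.
  - move=> i; apply: (measurableT_comp mGf).
    apply: measurable_fun_pair; last exact: measurable_cst.
    exact: measurable_addr addG _.
  - by [].
  - have [i Mi] := MN ((t, w.1), w.2); exists i.
    rewrite gee0_abs; last by rewrite mule_ge0// lee_fin ltW.
    apply: (@le_trans _ _ ((N ((t, w.1) + zs i)%R)%:E * (m (t, w.1))%:E)%E).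
      by apply: lee_wpmul2r => //; rewrite lee_fin ltW.
    rewrite /Gf -!EFinM lee_fin mulrCA ler_wpM2l//.
    exact: mk.
  exists i; rewrite gee0_abs ?Lnorm_ge0//; apply: (le_trans iP).
  rewrite (_ : Lnorm _ _ _ = H (tb (zs i).2 w.1))//.
  apply: (@Lnorm_preserving _ _ (borel (0 : G)) (borel (0 : G)) R mu mu
    (ta (zs i).1) _ _ p (fun x => Gf (x, tb (zs i).2 w.1))) => //.
  - exact: measurable_addr addG _.
  - by move=> A mA; exact: (haar_addr mu_haar).
  - exact: measurable_fun_pair1.
have mHfst : measurable_fun setT (H \o fst :
    borel (0 : Gd) * borel (1%g : circle R) -> \bar R).
  exact: measurableT_comp mH measurable_fst.
have cpk0 : 0 <= cp * k by rewrite mulr_ge0// ltW.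
have TP b := @product_measure_preserving1 _ _ (borel (0 : Gd))
  (borel (1%g : circle R)) R nu lam (tb b) (measurable_addr addGd b)
  (fun A mA => haar_addr nu_haar b mA).
have [||//|i iP] := cqP (fun i w => H (tb (zs i).2 w.1)) M1 (cp * k) cpk0.
- by move=> i; exact: (measurableT_comp mHfst (TP (zs i).2).1).
- by [].
rewrite /mixed_norm /Lpq_norm -/M1; apply: (le_trans iP).
rewrite mulrA.
have -> : Lnorm (nu \x lam)%E q
    (fun w : borel (0 : Gd) * borel (1%g : circle R) => H (tb (zs i).2 w.1)) =
    Lnorm (nu \x lam)%E q (H \o fst).
  exact: (Lnorm_preserving (TP (zs i).2).1 (TP (zs i).2).2 q0 mHfst).
(* The modulus of F does not see the circle variable, so its inner norm at w is H at the frequency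
   of w. *)
rewrite [X in (_ <= _ * X)%E](_ : _ = Lnorm (nu \x lam)%E q (H \o fst))//.
apply: eq_Lnorm => w; apply: eq_Lnorm => x.
by rewrite FN gee0_abs ?lee_fin.
Qed.

End mixed_norm_bound.

Lemma maximal_fun_le (R : realType) (G : topologicalZmodType)
    (mu : {sigma_finite_measure set (borel (0 : G)) -> \bar R})
    (nu : {sigma_finite_measure set (borel (0 : dual R G)) -> \bar R})
    (lam : {sigma_finite_measure set (borel (1%g : circle R)) -> \bar R})
    (Q : set (heisenberg R G)) (n : nat) (zs : 'I_n.+1 -> G * dual R G)
    (N : G * dual R G -> R) (F : heisenberg R G -> R[i]) :
  (0 < ((mu \x nu) \x lam)%E setT)%E ->
  (forall z, 0 <= N z) -> (forall h, cmod (F h) = N h.1) ->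
  (forall z k, Q k -> exists i, N (z + k.1) = N (z + zs i)) ->
  forall h, exists i,
    (`|maximal_fun mu nu lam Q F h| <= (N (h.1 + zs i)%R)%:E)%E.
Proof.
move=> mT N0 FN NQ h.
(* On h Q the modulus of F takes only values among the N (h.1 + zs i), and elsewhere the function is
   extended by 0; the largest of these values bounds it everywhere. *)
pose j := [arg max_(i > ord0) N (h.1 + zs i)]%O.
have Nj i : N (h.1 + zs i) <= N (h.1 + zs j).
  by rewrite /j; case: arg_maxP => // i0 _; apply.
exists j; rewrite gee0_abs.
  apply/ess_supP; apply: nearW => k; rewrite patchE; case: ifPn => [|_].
    rewrite inE => -[k' Qk' <-]; rewrite lee_fin FN.
    by have [i ->] := NQ h.1 k' Qk'.
  by rewrite lee_fin.
(* Nonnegativity uses the positive total mass: on a null space the essential supremum would be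
   -oo. *)
apply: ess_sup_gee => //; apply: nearW => k; rewrite patchE; case: ifPn => // _.
by rewrite lee_fin cmod_ge0.
Qed.

Theorem lemma3p38 (R : realType) (G : topologicalZmodType)
    (G_hausdorff : hausdorff_space G)
    (G_second_countable : @second_countable G)
    (G_sigma_compact : sigma_compact G)
    (G_locally_compact : locally_compact [set: G])
    (G_discrete_or_compact :
       (forall A : set G, open A) \/ compact [set: G])
    (mu : {sigma_finite_measure set (borel (0 : G)) -> \bar R})
    (nu : {sigma_finite_measure set (borel (0 : dual R G)) -> \bar R})
    (lam : {sigma_finite_measure set (borel (1%g : circle R)) -> \bar R})
    (mu_haar : haar_measure +%R mu)
    (nu_haar : haar_measure +%R nu)
    (mu_nu_dual : dual_haar_measures mu nu)
    (lam_haar : haar_measure (fun z w : circle R => (z * w)%g) lam)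
    (lam_mass : lam [set: borel (1%g : circle R)] = 1%E)
    (K : set G) (K_subgroup : open_compact_subgroup K)
    (g0 g1 : G -> R[i])
    (g0_test : special_test_functions K g0) (g0_neq0 : g0 <> (fun=> 0))
    (g1_test : special_test_functions K g1) (g1_neq0 : g1 <> (fun=> 0))
    (Q : set (heisenberg R G)) (Q_nbhs : unit_neighbourhood Q)
    (v : G * dual R G -> R) (v_admissible : admissible_weight v)
    (p q : \bar R) (p_gt0 : (0 < p)%E) (q_gt0 : (0 < q)%E)
    (m : G * dual R G -> R) (m_moderate : moderate_weight v m) :
  exists (g : G -> R[i]) (C : R),
    [/\ special_test_functions K g, g <> (fun=> 0), 0 < C &
        forall f : (G -> R[i]) -> R[i],
          modulation_space mu nu lam v g0 g1 Q p q m f ->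
          (wiener_norm mu nu lam Q p q m (wavelet g f) <=
           C%:E * Lpq_norm mu nu lam p q m (wavelet g f))%E].
Proof.
have [cK oK K0 KB] := K_subgroup.
have sK : open_subgroup K by split.
have addGd := @dual_addl_continuous R G K cK sK.
case: Q_nbhs => _ pQ nQ.
have [n [zs Qzs]] := precompact_finite_cosets cK sK pQ (nbhs_singleton nQ).
case: m_moderate => -[mm m0] [Cm mCm].
case: (v_admissible) => -[_ v0] _ _ _ _.
(* One constant for all the translations: the sum dominates each moderateness factor, the absolute
   value allows for any sign of [Cm], and 1 ensures positivity. *)
pose k := 1 + \sum_(i < n.+1) `|Cm| * v (- zs i).
have k0 : 0 < k.
  by rewrite ltr_pwDl// sumr_ge0// => i _; rewrite mulr_ge0// ltW.
have mk i z : m z <= k * m (z + zs i).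
  have -> : m z = m (- zs i + (z + zs i)) by rewrite addrC addrK.
  apply: le_trans (mCm _ _) _; rewrite ler_pM2r//.
  apply: (@le_trans _ _ (`|Cm| * v (- zs i)));
    first by rewrite ler_pM2r// ler_norm.
  rewrite /k (bigD1 i)//= addrCA lerDl addr_ge0// sumr_ge0// => j _.
  by rewrite mulr_ge0// ltW.
have [c c0 cP] := mixed_norm_le_translates addGd lam mu_haar nu_haar zs
  p_gt0 q_gt0 (ltW k0).
exists (gaussian R K), (c * k); split.
(* The window is its own time-frequency shift by zero. *)
- exists 1, (fun=> 1), (fun=> 0); apply/funext => y.
  rewrite big_ord1 mul1r /tfshift /modulation /translation /pairing/=.
  by rewrite subr0 mul1r.
- move=> /(congr1 (fun h => h 0)); rewrite /gaussian indicE mem_set//.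
  by apply/eqP; rewrite oner_eq0.
- exact: mulr_gt0.
move=> f [fR _].
have cw := cmod_wavelet G_hausdorff cK sK mu_haar nu_haar
  v_admissible g0_test fR.
have Ncoset := gaussian_stft_norm_coset G_hausdorff cK sK mu_haar nu_haar
  v_admissible g0_test fR.
apply: (cP (gaussian_stft_norm K f)) => //.
- by move=> z; exact: cmod_ge0.
- exact: (coset_invariant_measurable G_hausdorff cK sK mu_haar nu_haar).
apply: maximal_fun_le => //.
- have muxnuT : ((mu \x nu) setT = mu setT * nu setT)%E.
    by rewrite -setXTT product_measure1E.
  have -> : (((mu \x nu) \x lam) setT = (mu \x nu) setT * lam setT)%E.
    by rewrite -[in LHS]setXTT product_measure1E.
  rewrite muxnuT lam_mass mule1.
  by case: mu_haar nu_haar => _ muT _ [_ nuT _]; rewrite mule_gt0.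
- by move=> z; exact: cmod_ge0.
(* Since (k1, k2) lies in the coset of [zs i], translating both by (x, xi) keeps them in a common
   coset of K x P, on which the modulus of the transform is constant. *)
move=> [x xi] [[k1 k2] t] Qk.
have [i [/= zk1 zk2]] := Qzs _ Qk; exists i.
apply: (Ncoset (x + (zs i).1) (x + k1) (xi + (zs i).2) (xi + k2)).
  by rewrite /coset/= [x + k1]addrC addrKA.
by rewrite /coset/= [xi + k2]addrC addrKA.
Qed.
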